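(* Let $k_{\max}=k_{\max}(x)$ be a positive-integer-valued function with $\log k_{\max}(x)/\log x\to 0$ as $x\to\infty$. Choose $\alpha$ uniformly at random from $\{1,\ldots,x\}$. Then \[ \lim_{x\to\infty}\mathbb{P}\big(\forall\, 8\le k\le k_{\max}:\ L_k^{(\alpha)} \text{ is irreducible over }\mathbb{Q}\text{ and } G_{L_k^{(\alpha)}}=S_k\big)=1 . \]
   Context: The generalized Laguerre polynomial of degree $k$ and parameter $\alpha$ is \[ L_k^{(\alpha)}(x)=\sum_{j=0}^{k}\frac{(k+\alpha)(k-1+\alpha)\cdots(j+1+\alpha)}{(k-j)!\,j!}(-x)^j , \] the polynomial solution of $xy''+(\alpha+1-x)y'+ky=0$. For $g\in\mathbb{Q}[x]$ of degree $k$, $G_g$ denotes the Galois group over $\mathbb{Q}$ of the splitting field of $g$, viewed as a permutation group on the roots of $g$ (so $G_g\le S_k$). *)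

(* Defs.v *)
From HB Require Import structures.
From mathcomp Require Import all_boot all_order all_algebra all_fingroup all_field.
From mathcomp Require Import all_classical all_reals all_analysis.
Set Implicit Arguments. Unset Strict Implicit. Unset Printing Implicit Defensive.
Import Order.TTheory GRing.Theory Num.Theory.
Local Open Scope ring_scope.

Definition laguerre (k : nat) (a : rat) : {poly rat} :=
  \poly_(j < k.+1)
    ((\prod_(j.+1 <= i < k.+1) (i%:R + a)) / ((k - j)`! * j`!)%:R * (-1) ^+ j).

Definition galois_group_is_Sym (g : {poly rat}) : Prop :=
  forall (L : splittingFieldType rat) (E : {subfield L}) (rs : seq L),
    splittingFieldFor 1%VS (map_poly (in_alg L) g) E ->
    map_poly (in_alg L) g = (lead_coef g)%:A *: \prod_(r <- rs) ('X - r%:P) ->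
    forall s : {perm 'I_(size rs)},
      exists2 f, f \in 'Gal(E / 1%VS)%g &
        forall i : 'I_(size rs), f (rs`_i) = rs`_(s i).

Definition good_alpha (kmax : nat) (alpha : nat) : Prop :=
  forall k : nat, (8 <= k <= kmax)%N ->
    irreducible_poly (laguerre k alpha%:R) /\
    galois_group_is_Sym (laguerre k alpha%:R).

Definition prob_unif {R : realType} (n : nat) (P : nat -> Prop) : R :=
  (#|[set a : 'I_n | `[< P a.+1 >]]|)%:R / n%:R.

(* Main.v *)
(* Let K = kmax x and call j bad if no prime p > K divides alpha + j exactly once.
   A good j <= k makes the Newton polygon of the monic Laguerre polynomial at p
   have a single segment of positive slope, of slope 1/j and length j.  Hence a
   factor of degree d <= k/2 can only exist if all j in (k - d, k] are bad; then
   the numbers alpha + j, k - d < j <= k, are essentially products of primes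
   p <= K, and some such p > 4d divides one of them but divides
   alpha + 1, ..., alpha + i too rarely for the factor to exist.

   For the Galois group, j = 2 yields a transposition (a nontrivial inertia
   element, as the other roots are distinct modulo p).  The transpositions define
   blocks, say n blocks of size b with k = nb.  The polynomial whose roots are the
   products of the roots over the blocks is rational, and integrality of its
   Newton polygon shows that every good j is a product of an integer <= n and an
   integer <= b.  If n > 1, at least k/9 integers in [1, k] are not of this form,
   while few j are bad.

   All this holds simultaneously for all k <= K as soon as the numbers alpha + m
   have only small square divisors and, for every d, the mean over m <= d of the
   sum of log p over the primes p <= K dividing alpha + m is at most a small
   multiple of log x.  The mean over all integers is O(log K) = o(log x), so by
   the one-sided Hardy-Littlewood maximal inequality almost every alpha is fine. *)
Require Import Defs.
From HB Require Import structures.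
From mathcomp Require Import all_boot all_order all_algebra all_fingroup all_field.
From mathcomp Require Import all_classical all_reals all_analysis.
From mathcomp Require Import zify ring lra.
Set Implicit Arguments.
Unset Strict Implicit.
Unset Printing Implicit Defensive.
Import Order.TTheory GRing.Theory Num.Theory.
Import numFieldNormedType.Exports.
Local Open Scope classical_set_scope.
Local Open Scope ring_scope.

(** * Valuation rings *)

(** An extension of the p-adic valuation takes fractional values. It is represented by a valuation
    ring [O] missing 1/p, and the statement that x has valuation e/j becomes: x^j / p^e is a unit of
    [O]. Newton polygon arguments then turn into statements about units, plus one divisibility that
    comes from rationals having integral valuation. Primes above k are used because such a prime
    divides at most one of alpha + 1, ..., alpha + k, no binomial coefficient C(k, j) and not k!; a
    single factor alpha + j therefore decides the whole polygon.

    The obstacle is uniformity. K may exceed every power of log x, while Markov's inequality for one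
    d only gives an exceptional density of order log K / log x, so a union bound over d is useless.
    The maximal inequality handles all windows starting at alpha + 1 at once, but a run of bad j is
    a window (k - d, k] far from the start. Primes p > 4d link the two: if p divides a term of the
    run and still excludes no factor, then p also divides an early term, or p^2 a slightly later
    one, and the weight of p is charged to an initial window. *)

Section ExtendValuation.
Variables (M : fieldType) (iota : {rmorphism rat -> M}) (p : nat).
Hypothesis p_pr : prime p.

Lemma natr_eq0_rat n : (n%:R == 0 :> M) = (n == 0)%N.
Proof. by rewrite -(rmorph_nat iota) fmorph_eq0 pnatr_eq0. Qed.

Lemma invp_not_int (z : int) : z%:~R != p%:R^-1 :> M.
Proof.
apply/eqP => /(congr1 ( *%R p%:R)).
rewrite mulfV ?natr_eq0_rat; last by rewrite -lt0n prime_gt0.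
rewrite -(rmorph_int iota) -(rmorph_nat iota) -rmorphM => e1.
have e2 : p%:R * z%:~R = 1 :> rat by apply: (fmorph_inj iota); rewrite e1 rmorph1.
have e3 : (p%:Z * z = 1)%R.
  by apply/eqP; rewrite -(@eqr_int rat) intrM e2.
have := congr1 absz e3; rewrite abszM /= => /eqP.
by rewrite muln_eq1 => /andP[/eqP p1 _]; move: p_pr; rewrite p1.
Qed.

Definition avoiding_subring (A : set M) :=
  [/\ A 1, forall x y, A x -> A y -> A (x - y),
      forall x y, A x -> A y -> A (x * y) & ~ A p%:R^-1].

Lemma maximal_avoiding_subring : exists A : set M,
  avoiding_subring A /\ forall B, avoiding_subring B -> A `<=` B -> B `<=` A.
Proof.
pose P (A : set M) := A = set0 \/ avoiding_subring A.
have [|A [PA maxA]] := @Zorn_bigcup M P.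
  move=> F FP Ftot.
  have [F0|] := pselect (forall A, F A -> A = set0).
    left; rewrite -subset0 => x [A FA]; by rewrite (F0 _ FA).
  move=> /existsNP[A0 /not_implyP[FA0 A0n]]; right.
  have FP' A : F A -> A !=set0 -> avoiding_subring A.
    by move=> FA /set0P/eqP An; case: (FP _ FA).
  have [A01 _ _ _] : avoiding_subring A0 by apply: FP' => //; apply/set0P/eqP.
  have two x y : (\bigcup_(X in F) X) x -> (\bigcup_(X in F) X) y ->
      exists2 A, F A & A x /\ A y.
    move=> [A FA Ax] [B FB By]; have [AB|BA] := Ftot _ _ FA FB.
      by exists B => //; split => //; exact: AB.
    by exists A => //; split => //; exact: BA.
  split.
  - by exists A0.
  - move=> x y Ux Uy; have [A FA [Ax Ay]] := two _ _ Ux Uy.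
    have [||_ AB _ _] := FP' A => //; first by exists x.
    by exists A => //; apply: AB.
  - move=> x y Ux Uy; have [A FA [Ax Ay]] := two _ _ Ux Uy.
    have [||_ _ AM _] := FP' A => //; first by exists x.
    by exists A => //; apply: AM.
  - move=> [A FA Ap]; have [||_ _ _] := FP' A => //; first by exists p%:R^-1.
exists A; have Zgood : avoiding_subring [set x | exists z : int, x = z%:~R].
  split.
  - by exists 1.
  - by move=> _ _ [z ->] [t ->]; exists (z - t); rewrite intrB.
  - by move=> _ _ [z ->] [t ->]; exists (z * t); rewrite intrM.
  - by move=> [z e]; move: (invp_not_int z); rewrite e eqxx.
have goodA : avoiding_subring A.
  case: PA => // A0; exfalso.
  apply: (maxA [set x | exists z : int, x = z%:~R]); last by right.
  rewrite A0 properEneq; split; last by move=> ?.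
  by apply/eqP => /seteqP[_ /(_ 1)]; apply; exists 1.
split => // B goodB AB; apply: contrapT => nBA.
by apply: (maxA B); [split | right].
Qed.

(** Adjoining z produces the ring of all values h.[z], so maximality becomes a test on polynomials
    over [O]. *)
Lemma maximal_avoiding_pred : exists O : subringClosed M,
  p%:R^-1 \notin O /\
  forall z, (forall h, h \is a polyOver O -> h.[z] != p%:R^-1) -> z \in O.
Proof.
have [A [[A1 AB AM Ap] maxA]] := maximal_avoiding_subring.
pose Op : {pred M} := fun x => `[< A x >].
have Opsub : subring_closed Op.
  split; rewrite /in_mem /=; first exact/asboolP.
  - by move=> x y /asboolP Ax /asboolP Ay; apply/asboolP/AB.
  - by move=> x y /asboolP Ax /asboolP Ay; apply/asboolP/AM.
pose O : subringClosed M :=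
  HB.pack_for (subringClosed M) Op (GRing.isSubringClosed.Build M Op Opsub).
have OE x : (x \in O) <-> A x by split=> /asboolP.
exists O; split; first by apply/negP => /OE.
move=> z zP; apply/OE.
apply: (maxA [set y | exists2 h : {poly M}, h \is a polyOver O & y = h.[z]]).
- split.
  + by exists 1; rewrite ?rpred1 ?hornerC.
  + by move=> _ _ [h Oh ->] [g Og ->]; exists (h - g); rewrite ?rpredB ?hornerD ?hornerN.
  + by move=> _ _ [h Oh ->] [g Og ->]; exists (h * g); rewrite ?rpredM ?hornerM.
  + by move=> [h Oh e]; move: (zP h Oh); rewrite e eqxx.
- by move=> x /OE Ox; exists x%:P; rewrite ?polyOverC ?hornerC.
- by exists 'X; rewrite ?polyOverX ?hornerX.
Qed.

(* Chevalley: a subring that is maximal among those avoiding [1/p] is a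
   valuation ring. *)
Lemma exists_valuation_ring : exists O : subringClosed M,
  p%:R^-1 \notin O /\ forall x, (x \in O) || (x^-1 \in O).
Proof.
have [ O [Op maxO]] := maximal_avoiding_pred.
exists O; split => //.
have pn0 : p%:R != 0 :> M by rewrite natr_eq0_rat -lt0n prime_gt0.
(* If the inverse of u = 1 - p b were missing, 1/p would equal some h.[u^-1]. Multiplying by u^n,
   which is again of the form 1 - p b', clears denominators and puts 1/p into [O]. *)
have unitO b : b \in O -> 1 - p%:R * b != 0 /\ (1 - p%:R * b)^-1 \in O.
  move=> Ob; have ne : 1 - p%:R * b != 0.
    apply: contraNneq Op => /eqP; rewrite subr_eq0 => /eqP e.
    by rewrite -[p%:R^-1]mulr1 {2}e mulKf.
  split => //; apply: maxO => h Oh; apply: contraNneq Op => he.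
  set u := 1 - p%:R * b in ne he *; set n := size h.
  have Ou : u \in O by rewrite rpredB ?rpredM ?rpred1 ?rpred_nat.
  have [b' Ob' eb'] : exists2 b', b' \in O & u ^+ n = 1 - p%:R * b'.
    elim: n => [|n [b' Ob' e]]; first by exists 0; rewrite ?rpred0 // mulr0 subr0.
    exists (b' + b - p%:R * b' * b); first by rewrite rpredB ?rpredD ?rpredM ?rpred_nat.
    by rewrite exprS e /u; ring.
  have : p%:R^-1 * u ^+ n \in O.
    rewrite -he horner_coef mulr_suml rpred_sum // => i _.
    rewrite exprVn -mulrA rpredM ?(polyOverP Oh) //.
    have ui0 : u ^+ i != 0 by rewrite expf_neq0.
    have -> : u ^- i * u ^+ n = u ^+ (n - i).
      by apply: (mulfI ui0); rewrite mulrA mulfV // mul1r -exprD subnKC // ltnW.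
    exact: rpredX.
  rewrite eb' mulrBr mulr1 mulKf // => H.
  by have := rpredD H Ob'; rewrite subrK.
(* Descent on the total size: multiplied by x^n, the relation for [g] writes x^n as p u times a
   combination of lower powers of x. Substituting this for the leading term of the longer polynomial
   [h] shortens it. *)
have key N x h g : x != 0 -> h \is a polyOver O -> g \is a polyOver O ->
    (size h + size g <= N)%N -> h.[x] = p%:R^-1 -> g.[x^-1] = p%:R^-1 -> False.
  elim: N x h g => [|N IH] x h g x0 Oh Og.
    rewrite leqn0 addn_eq0 => /andP[/eqP]; rewrite (rwP eqP) size_poly_eq0.
    move=> /eqP-> _; rewrite horner0 => /esym/eqP.
    by rewrite invr_eq0 (negbTE pn0).
  wlog le_gh : x h g x0 Oh Og / (size g <= size h)%N.
    move=> H sz hx gx; have [le|/ltnW le] := leqP (size g) (size h).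
      exact: (H x h g).
    by apply: (H x^-1 g h); rewrite ?invrK ?invr_eq0 // addnC.
  move=> sz hx gx.
  have szh : (0 < size h)%N.
    rewrite lt0n size_poly_eq0; apply: contra_eqN hx => /eqP->.
    by rewrite horner0 eq_sym invr_eq0.
  have szg : (0 < size g)%N.
    rewrite lt0n size_poly_eq0; apply: contra_eqN gx => /eqP->.
    by rewrite horner0 eq_sym invr_eq0.
  pose n := (size h).-1; pose m := (size g).-1.
  have nE : size h = n.+1 by rewrite /n prednK.
  have mE : size g = m.+1 by rewrite /m prednK.
  have le_mn : (m <= n)%N by rewrite -ltnS -nE -mE.
  have [u0 Ou] := unitO g`_0 (polyOverP Og 0%N); set u := (_)^-1 in Ou.
  pose q := \sum_(i < m) g`_i.+1 *: 'X^(n - i.+1) : {poly M}.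
  have Oq : q \is a polyOver O.
    by rewrite rpred_sum // => i _; rewrite polyOverZ ?polyOverXn ?(polyOverP Og).
  have qx : p%:R * u * q.[x] = x ^+ n.
    have : p%:R * (g.[x^-1] - g`_0) = 1 - p%:R * g`_0 by rewrite gx mulrBr mulfV.
    rewrite horner_coef mE big_ord_recl /= expr0 mulr1 addrAC subrr add0r => e.
    apply: (mulfI u0); rewrite mulrA mulrCA /u mulfV // mulr1 -e -!mulrA.
    congr (_ * _); rewrite mulr_suml horner_sum; apply: eq_bigr => i _.
    rewrite hornerZ hornerXn -mulrA; congr (_ * _).
    rewrite expfB_cond ?(negbTE x0) /= ?add0n; last exact: leq_trans (ltn_ord i) le_mn.
    by rewrite exprVn mulrC.
  pose h' := h + (lead_coef h)%:P * ((p%:R * u)%:P * q - 'X^n).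
  have Oh' : h' \is a polyOver O.
    have Ol : lead_coef h \in O by apply: (polyOverP Oh).
    by rewrite rpredD // rpredM ?polyOverC // rpredB ?polyOverXn // rpredM ?polyOverC // rpredM ?rpred_nat.
  apply: (IH x h' g) => //.
    rewrite nE addSn ltnS in sz; apply: leq_trans sz; rewrite leq_add2r.
    apply/leq_sizeP => i le_ni; rewrite coefD coefCM coefB coefXn coefCM.
    have qi : q`_i = 0.
      rewrite coef_sum big1 // => t _; rewrite coefZ coefXn.
      rewrite (_ : (i == _) = false) ?mulr0 //; apply/eqP => iE.
      by have := ltn_ord t; move: le_ni le_mn; rewrite iE; clear; lia.
    rewrite qi mulr0 sub0r; have [->|ne] := eqVneq i n.
      by rewrite /lead_coef nE /= mulrN1 subrr.
    rewrite mulrN mulr0 oppr0 addr0 nth_default // nE ltn_neqAle eq_sym ne //.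
  by rewrite hornerD hx hornerM hornerC hornerD hornerN hornerM hornerC hornerXn qx subrr mulr0 addr0.
move=> x; have [->|x0] := eqVneq x 0; first by rewrite rpred0.
apply/orP; apply: contrapT => /not_orP[nx nxV].
have get z : ~ (z \in O) -> exists2 h, h \is a polyOver O & h.[z] = p%:R^-1.
  move=> nz; apply: contrapT => H; apply: nz; apply: maxO => h Oh.
  by apply/eqP => e; apply: H; exists h.
have [h Oh hx] := get _ nx; have [g Og gx] := get _ nxV.
exact: (key _ x h g x0 Oh Og (leqnn _) hx gx).
Qed.

End ExtendValuation.
Section ValuationRing.
Variables (M : fieldType) (O : subringClosed M).
Hypothesis valO : forall x, (x \in O) || (x^-1 \in O).

(** The maximal ideal of [O]. Zero is added by hand because 0^-1 = 0 lies in [O]. *)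
Definition videal : {pred M} := fun x => (x == 0) || (x^-1 \notin O).
Definition vunit (x : M) : bool := (x \in O) && (x \notin videal).

Lemma videalE x : (x \in videal) = (x == 0) || (x^-1 \notin O).
Proof. by []. Qed.

Lemma videal0 : 0 \in videal.
Proof. by rewrite videalE eqxx. Qed.

Lemma videal1 : 1 \notin videal.
Proof. by rewrite videalE oner_eq0 invr1 rpred1. Qed.

Lemma videal_sub x : x \in videal -> x \in O.
Proof.
rewrite videalE => /orP[/eqP->|]; first exact: rpred0.
by have /orP[//|->] := valO x.
Qed.

Lemma videalMl a x : a \in O -> x \in videal -> a * x \in videal.
Proof.
move=> Oa mx; rewrite videalE; have [->//|ax0] := eqVneq (a * x) 0 => /=.
move: ax0; rewrite mulf_eq0 negb_or => /andP[a0 x0].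
move: mx; rewrite videalE (negbTE x0) /=; apply: contra => H.
by rewrite (_ : x^-1 = a * (a * x)^-1) ?rpredM // invfM mulrA mulfV // mul1r.
Qed.

Lemma videalMr a x : a \in O -> x \in videal -> x * a \in videal.
Proof. by rewrite mulrC; apply: videalMl. Qed.

Lemma videalN x : (- x \in videal) = (x \in videal).
Proof. by rewrite !videalE oppr_eq0 invrN rpredN. Qed.

Lemma videalD x y : x \in videal -> y \in videal -> x + y \in videal.
Proof.
wlog xy : x y / x / y \in O.
  move=> H mx my; have /orP[xy|yx] := valO (x / y); first exact: H.
  by rewrite addrC; apply: H => //; rewrite invf_div in yx.
move=> mx my; have [->|y0] := eqVneq y 0; first by rewrite addr0.
rewrite (_ : x + y = (x / y + 1) * y); last by rewrite mulrDl mul1r divfK.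
by rewrite videalMl // rpredD ?rpred1.
Qed.

Lemma videal_sum (I : eqType) (r : seq I) (F : I -> M) :
  {in r, forall i, F i \in videal} -> \sum_(i <- r) F i \in videal.
Proof.
move=> H; rewrite big_seq; elim/big_rec: _ => [|i x ir mx]; first exact: videal0.
by apply: videalD => //; exact: H.
Qed.

Lemma vunit_neq0 x : vunit x -> x != 0.
Proof. by case/andP=> _; apply: contraNneq => ->; exact: videal0. Qed.

Lemma vunitE x : vunit x = [&& x != 0, x \in O & x^-1 \in O].
Proof.
by rewrite /vunit videalE negb_or negbK andbCA.
Qed.

Lemma vunitV x : vunit x^-1 = vunit x.
Proof. by rewrite !vunitE invr_eq0 invrK [(_ \in O) && _]andbC. Qed.

Lemma vunitM x y : vunit x -> vunit y -> vunit (x * y).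
Proof.
rewrite !vunitE => /and3P[x0 Ox Ox'] /and3P[y0 Oy Oy'].
by rewrite mulf_neq0 //= invfM !rpredM.
Qed.

Lemma vunit_div x y : vunit x -> vunit y -> vunit (x / y).
Proof. by move=> ux uy; rewrite vunitM ?vunitV. Qed.

Lemma vunit1 : vunit 1.
Proof. by rewrite /vunit rpred1 videal1. Qed.

Lemma vunitN x : vunit (- x) = vunit x.
Proof. by rewrite /vunit rpredN videalN. Qed.

Lemma vunitX x n : vunit x -> vunit (x ^+ n).
Proof.
by move=> ux; elim: n => [|n IH]; rewrite ?vunit1 // exprS vunitM.
Qed.

Lemma vunit_prod (I : eqType) (r : seq I) (F : I -> M) :
  {in r, forall i, vunit (F i)} -> vunit (\prod_(i <- r) F i).
Proof.
move=> H; rewrite big_seq; elim/big_rec: _ => [|i x ir mx]; first exact: vunit1.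
by apply: vunitM => //; exact: H.
Qed.

Lemma vunitDm x y : vunit x -> y \in videal -> vunit (x + y).
Proof.
move=> /andP[Ox mx] my; apply/andP; split; first by apply: rpredD => //; exact: videal_sub.
apply: contra mx => mxy; rewrite -(addrK y x); apply: videalD => //; by rewrite videalN.
Qed.

Lemma videal_prime x y : x \in O -> y \in O -> x * y \in videal ->
  (x \in videal) || (y \in videal).
Proof.
move=> Ox Oy; apply: contraLR; rewrite negb_or => /andP[nx ny].
have : vunit (x * y) by rewrite vunitM /vunit ?Ox ?Oy.
by case/andP.
Qed.

Lemma valring_root x n : (0 < n)%N -> x ^+ n \in O -> x \in O.
Proof.
move=> n0 Oxn; have /orP[//|Ox'] := valO x.
apply: contraLR (videal1) => nOx; rewrite negbK.
have x0 : x != 0 by apply: contraNneq nOx => ->; exact: rpred0.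
rewrite -(mulfV (expf_neq0 n x0)) videalMl // -exprVn -(prednK n0) exprS.
by rewrite videalMr ?rpredX // videalE invr_eq0 invrK nOx orbT.
Qed.

Lemma videal_root x n : (0 < n)%N -> x ^+ n \in videal -> x \in videal.
Proof.
move=> n0 mxn; have Ox := valring_root n0 (videal_sub mxn).
apply: contraLR mxn => nmx.
by have /(vunitX n)/andP[] : vunit x by rewrite /vunit Ox.
Qed.

Lemma vunit_root x n : (0 < n)%N -> vunit (x ^+ n) -> vunit x.
Proof.
move=> n0 /andP[Oxn mxn]; rewrite /vunit (valring_root n0) //=.
by apply: contra mxn => mx; rewrite -(prednK n0) exprS videalMr ?rpredX ?videal_sub.
Qed.

Lemma videalX x n : (0 < n)%N -> x \in videal -> x ^+ n \in videal.
Proof. by move=> n0 mx; rewrite -(prednK n0) exprS videalMr ?rpredX ?videal_sub. Qed.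

Lemma integral_valring (h : {poly M}) x :
  h \is monic -> h \is a polyOver O -> root h x -> x \in O.
Proof.
move=> mh Oh /eqP hx; have /orP[//|Ox'] := valO x.
have [->|x0] := eqVneq x 0; first exact: rpred0.
have szh : (0 < size h)%N by rewrite lt0n size_poly_eq0 monic_neq0.
pose n := (size h).-1; have nE : size h = n.+1 by rewrite prednK.
move: hx; rewrite horner_coef nE big_ord_recr /= => /eqP.
rewrite addr_eq0 => /eqP/esym/(congr1 -%R); rewrite opprK.
have -> : h`_n = 1 by move/monicP: mh; rewrite /lead_coef nE.
rewrite mul1r; case: n {nE} => [|n] e; first by move: e; rewrite big_ord0 oppr0 => /eqP; rewrite oner_eq0.
rewrite (_ : x = x ^+ n.+1 / x ^+ n); last by rewrite exprS mulfK ?expf_neq0.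
rewrite e mulNr rpredN mulr_suml rpred_sum // => i _.
rewrite -mulrA rpredM ?(polyOverP Oh) //.
rewrite (_ : x ^+ i / x ^+ n = x^-1 ^+ (n - i)) ?rpredX //.
rewrite exprVn expfB_cond ?(negbTE x0) ?add0n -1?ltnS // invf_div //.
Qed.

Lemma coef_prod_1subZX (s : seq M) : {in s, forall y, y \in videal} ->
  forall i, (\prod_(y <- s) (1 - y *: 'X))`_i - (i == 0%N)%:R \in videal.
Proof.
elim: s => [_ i|y s IH ms i].
  by rewrite big_nil coef1 subrr videal0.
rewrite big_cons mulrBl mul1r coefB addrAC videalD //.
  by apply: IH => z zs; apply: ms; rewrite inE zs orbT.
rewrite videalN -scalerAl coefZ mulrC videalMl ?ms ?inE ?eqxx // coefXM.
case: eqP => _; first exact: rpred0.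
set t := _`_ _; rewrite -(subrK (i.-1 == 0%N)%:R t) rpredD ?rpred_nat //.
by apply: videal_sub; apply: IH => z zs; apply: ms; rewrite inE zs orbT.
Qed.

Lemma polyOver_prod_XsubC (I : eqType) (l : seq I) (b : I -> M) :
  {in l, forall i, b i \in O} -> \prod_(x <- l) ('X - (b x)%:P) \is a polyOver O.
Proof.
move=> Ol; rewrite big_seq rpred_prod // => x xl.
by rewrite rpredB ?polyOverX ?polyOverC ?Ol.
Qed.

(** Modulo the ideal the second product is 1 and the first is monic of degree [size l]. *)
Lemma coef_vertex (l s : seq M) :
  {in l, forall x, x \in O} -> {in s, forall y, y \in videal} ->
  (\prod_(x <- l) ('X - x%:P) * \prod_(y <- s) (1 - y *: 'X))`_(size l) - 1 \in videal.
Proof.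
move=> Ol ms; set P := \prod_(x <- l) _; set Q := \prod_(y <- s) _.
have OP : P \is a polyOver O := polyOver_prod_XsubC Ol.
rewrite coefM big_ord_recr /= subnn.
have -> : P`_(size l) = 1.
  have : P \is monic := monic_prod_XsubC _ _ _.
  by move=> /monicP; rewrite /lead_coef size_prod_XsubC.
rewrite mul1r -addrA videalD //; last exact: (coef_prod_1subZX ms 0).
apply: videal_sum => i _; rewrite mulrC.
apply: videalMr; first exact: (polyOverP OP).
have := coef_prod_1subZX ms (size l - i).
by rewrite subn_eq0 leqNgt ltn_ord subr0.
Qed.

Lemma coef_comp_scaleX (R : comNzRingType) (c : R) (q : {poly R}) i :
  (q \Po (c *: 'X))`_i = q`_i * c ^+ i.
Proof.
rewrite comp_polyE coef_sum.
transitivity (\sum_(t < size q) (if i == t :> nat then q`_i * c ^+ i else 0)).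
  apply: eq_bigr => t _; rewrite exprZn scalerA coefZ coefXn.
  by case: eqP => [->|_]; rewrite ?mulr1 ?mulr0.
case: (ltnP i (size q)) => [lt_i|le_i].
  rewrite (bigD1 (Ordinal lt_i)) //= eqxx big1 ?addr0 // => t.
  by rewrite -val_eqE /= eq_sym => /negbTE->.
rewrite big1 ?nth_default ?mul0r // => t _.
by rewrite gtn_eqF // (leq_trans (ltn_ord t)).
Qed.

(* A vertex of the Newton polygon of a product of linear factors: the roots of
   valuation at least that of [c] are separated from those of smaller
   valuation. *)
Lemma coef_vertex_scaled (c : M) (l s : seq M) : c != 0 ->
  {in l, forall x, x / c \in O} ->
  {in s, forall y, y != 0 /\ c / y \in videal} ->
  vunit ((\prod_(x <- l ++ s) ('X - x%:P))`_(size l) / \prod_(y <- s) y).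
Proof.
move=> c0 Ol ms.
have s0 : \prod_(y <- s) y != 0.
  by rewrite prodf_seq_neq0; apply/allP => y /ms[y0 _]; exact/implyP.
pose Q := \prod_(y <- s) (1 - y^-1 *: 'X).
pose P := \prod_(x <- l) ('X - x%:P).
have eS : \prod_(y <- s) ('X - y%:P) = (\prod_(y <- s) (- y)) *: Q.
  rewrite /Q -scaler_prod big_seq [RHS]big_seq; apply: eq_bigr => y /ms[y0 _].
  by rewrite scalerBr scalerA mulNr mulfV // scaleN1r opprK alg_polyC polyCN addrC.
rewrite big_cat /= eS -scalerAr coefZ mulrAC.
apply: vunitM.
  rewrite -prodf_div big_seq; elim/big_rec: _ => [|y u /ms[y0 _] uu]; first exact: vunit1.
  by rewrite vunitM // mulNr mulfV // vunitN vunit1.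
set n := size l; rewrite -/P.
(* Substituting c X for the variable divides the roots in [l] by c and turns each y^-1 into c / y,
   which is the situation of [coef_vertex]. *)
have e : (P * Q)`_n = ((\prod_(x <- [seq x / c | x <- l]) ('X - x%:P)) *
   \prod_(y <- [seq c / y | y <- s]) (1 - y *: 'X))`_n.
  apply: (mulIf (expf_neq0 n c0)); rewrite -coef_comp_scaleX comp_polyM.
  rewrite !big_map /Q /P !rmorph_prod /=.
  have -> : \prod_(y <- s) ((1 - y^-1 *: 'X) \Po (c *: 'X)) =
            \prod_(y <- s) (1 - c / y *: 'X) :> {poly M}.
    apply: eq_bigr => y _.
    by rewrite comp_polyB comp_polyZ comp_polyX scalerA mulrC -(polyC1 M) comp_polyC.
  have -> : \prod_(x <- l) (('X - x%:P) \Po (c *: 'X)) =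
            (c ^+ n) *: \prod_(x <- l) ('X - (x / c)%:P).
    have -> : c ^+ n = \prod_(x <- l) c.
      by rewrite big_const_seq iter_mulr_1 count_predT.
    rewrite -scaler_prod; apply: eq_bigr => x _.
    rewrite comp_polyB comp_polyX comp_polyC scalerBr -!mul_polyC -polyCM.
    by rewrite [c * _]mulrC divfK.
  by rewrite -scalerAl coefZ mulrC.
rewrite e -(subrK 1 _`_n) addrC vunitDm ?vunit1 //.
rewrite /n -(size_map (fun x => x / c) l); apply: coef_vertex.
  by move=> _ /mapP[x xl ->]; exact: Ol.
by move=> _ /mapP[y ys ->]; case: (ms y ys).
Qed.

(** Otherwise the factor with roots [sg] has a unit as constant term, so the lowest term of f modulo
    the ideal is that of the other factor. The latter is monic, hence nonzero modulo the ideal, and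
    has degree [size sh]. *)
Lemma factor_root_in_ideal (sg sh : seq M) (f : {poly M}) :
  f = \prod_(x <- sg ++ sh) ('X - x%:P) ->
  {in sg ++ sh, forall x, x \in O} ->
  (forall l, (l <= size sh)%N -> f`_l \in videal) -> has (mem videal) sg.
Proof.
move=> fE Os mf; apply: contraT => nsg.
pose P := \prod_(x <- sg) ('X - x%:P); pose Q := \prod_(x <- sh) ('X - x%:P).
have uP0 : vunit P`_0.
  rewrite coef0_prod_XsubC vunitM ?vunitX ?vunitN ?vunit1 //.
  apply: vunit_prod => x xs; rewrite /vunit Os ?mem_cat ?xs //=.
  by move/hasPn: nsg; apply.
have OP : P \is a polyOver O by apply: polyOver_prod_XsubC => x xs; rewrite Os // mem_cat xs.
have OQ : Q \is a polyOver O by apply: polyOver_prod_XsubC => x xs; rewrite Os // mem_cat xs orbT.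
have exQ : exists l, Q`_l \notin videal.
  exists (size sh); have /monicP : Q \is monic := monic_prod_XsubC _ _ _.
  by rewrite /lead_coef size_prod_XsubC => ->; exact: videal1.
case: (ex_minnP exQ) => l nl minl.
have lsh : (l <= size sh)%N.
  rewrite leqNgt; apply: contra nl => lt.
  by rewrite nth_default ?videal0 // size_prod_XsubC.
have := mf l lsh; rewrite fE big_cat /= -/P -/Q coefM big_ord_recl subn0 /=.
set S := \sum_(_ < _) _ => mS.
have mS' : S \in videal.
  apply: videal_sum => // i _; apply: videalMl; first exact: (polyOverP OP).
  apply: contraT => /minl; rewrite /bump /=; have := ltn_ord i; lia.
have : vunit (P`_0 * Q`_l) by rewrite vunitM // /vunit (polyOverP OQ).
case/andP => _; rewrite -(addrK S (_ * _)) videalD // ?videalN //.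
Qed.

End ValuationRing.

(** * Rational numbers and rational polynomials under the extended valuation *)

Section PadicValuationRing.
Variables (M : fieldType) (iota : {rmorphism rat -> M}) (p : nat).
Variables (O : subringClosed M).
Hypothesis p_pr : prime p.
Hypothesis valO : forall x, (x \in O) || (x^-1 \in O).
Hypothesis Op : p%:R^-1 \notin O.
Local Notation mm := (videal O).
Local Notation uu := (vunit O).

Lemma natr_neq0 n : (0 < n)%N -> n%:R != 0 :> M.
Proof. by rewrite (natr_eq0_rat iota) -lt0n. Qed.
Let pn0 : p%:R != 0 :> M.
Proof. by rewrite natr_neq0 ?prime_gt0. Qed.

Lemma videal_p : p%:R \in mm.
Proof. by rewrite videalE Op orbT. Qed.

Lemma videal_natr n : (n%:R \in mm) = (p %| n)%N.
Proof.
apply/idP/idP => [mn|/dvdnP[q ->]]; last first.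
  by rewrite natrM videalMl ?rpred_nat ?videal_p.
apply: contraLR mn; rewrite -prime_coprime // => co.
case: (egcdnP n (prime_gt0 p_pr)) => u v e _.
apply: contra (videal1 O) => mn; move: co; rewrite /coprime => /eqP co.
rewrite co in e; have : (u * p)%:R = (v * n)%:R + 1 :> M by rewrite e natrD.
move=> e'; rewrite (_ : 1 = (u * p)%:R - (v * n)%:R); last by rewrite e' addrC addKr.
by rewrite videalD ?videalN // natrM videalMl ?rpred_nat ?videal_p.
Qed.

Lemma vunit_natr n : uu n%:R = ~~ (p %| n)%N.
Proof. by rewrite /vunit rpred_nat videal_natr. Qed.

Lemma vp_inj a b : uu (p%:R ^+ a / p%:R ^+ b) -> a = b.
Proof.
wlog le_ab : a b / (a <= b)%N.
  move=> H u; have [/H|/ltnW/H] := leqP a b; first exact.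
  by move=> ->//; rewrite -vunitV invf_div.
rewrite -(subnK le_ab) exprD; case: (b - a)%N => [//|n].
rewrite invfM mulrCA mulfV ?expf_neq0 // mulr1 vunitV => /andP[_].
by rewrite videalX ?videal_p.
Qed.

Lemma vunit_natr_part n : (0 < n)%N -> uu (n%:R / p%:R ^+ logn p n).
Proof.
move=> n0; have [m co e] := pfactor_coprime p_pr n0.
by rewrite {1}e natrM natrX mulfK ?expf_neq0 // vunit_natr -prime_coprime.
Qed.

(** The integer valuation of q is b - a; two exponents keep it within the naturals. *)
Lemma vunit_rat (q : rat) : q != 0 ->
  exists a b, uu (iota q * p%:R ^+ a / p%:R ^+ b).
Proof.
move=> q0; have numq0 : (0 < `|numq q|)%N by rewrite absz_gt0 numq_eq0.
have denq0 : (0 < `|denq q|)%N by rewrite absz_gt0 denq_neq0.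
exists (logn p `|denq q|), (logn p `|numq q|).
have -> : iota q = (-1) ^+ (numq q < 0)%R * (`|numq q|%N)%:R / (`|denq q|%N)%:R.
  rewrite -{1}(divq_num_den q) fmorph_div !rmorph_int; congr (_ / _).
    by rewrite {1}(intEsign (numq q)) intrM rmorphXn /= rmorphN1 /= -pmulrn.
  by rewrite -{1}(absz_denq q) -pmulrn.
have rearr (u N D A B : M) : u * N / D * A / B = u * ((N / B) * (D / A)^-1).
  rewrite invf_div -!mulrA; congr (_ * (_ * _)).
  by rewrite mulrCA [RHS]mulrCA [D^-1 * _]mulrC.
rewrite rearr; apply: vunitM; first by rewrite vunitX // vunitN vunit1.
by apply: vunitM; rewrite ?vunitV; exact: vunit_natr_part.
Qed.

(** A rational has integral valuation, so positive means at least 1. *)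
Lemma rat_videal_div (q : rat) : iota q \in mm -> iota q / p%:R \in O.
Proof.
have [->|q0] := eqVneq q 0; first by rewrite rmorph0 mul0r rpred0.
have [a [b u]] := vunit_rat q0 => mq.
have [le_ba|lt_ab] := leqP b a.
  case/andP: u => _; rewrite -(subnK le_ba) exprD mulrA mulfK ?expf_neq0 //.
  by rewrite videalMr ?rpredX ?rpred_nat.
rewrite (_ : _ / _ = (iota q * p%:R ^+ a / p%:R ^+ b) * p%:R ^+ (b - a.+1)).
  by rewrite rpredM ?rpredX ?rpred_nat //; case/andP: u.
rewrite -{1}(subnK lt_ab) [in RHS]exprD exprS; field.
by rewrite pn0 !expf_neq0.
Qed.

(** The root b i has valuation e i / j. If n roots attain the maximal value m / j, their product is,
    up to a unit, the quotient of the constant coefficient of g by its n-th one. That quotient is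
    rational, so m n / j is an integer. *)
Lemma vertex_dvd (I : eqType) (r : seq I) (b : I -> M) (e : I -> nat)
    (j m : nat) (g : {poly rat}) : (0 < j)%N ->
  map_poly iota g = \prod_(i <- r) ('X - (b i)%:P) ->
  {in r, forall i, uu (b i ^+ j / p%:R ^+ e i)} ->
  {in r, forall i, e i <= m}%N ->
  (j %| m * count (fun i => e i == m) r)%N.
Proof.
move=> j0 eg ub em; set a := fun i => e i == m.
have b0 i : i \in r -> b i != 0.
  move=> /ub/vunit_neq0; apply: contraNneq => ->.
  by rewrite expr0n gtn_eqF // mul0r.
have [/eqP c0|] := eqVneq (count a r) 0%N; first by rewrite (eqP c0) muln0.
rewrite -lt0n -has_count => /hasP[i0 i0r /eqP ei0].
pose l := [seq b i | i <- r & a i]; pose s := [seq b i | i <- r & predC a i].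
have szl : size l = count a r by rewrite size_map size_filter.
have prodE (R : comNzRingType) (f : I -> R) : \prod_(i <- r) f i =
    (\prod_(i <- r | a i) f i) * \prod_(i <- r | predC a i) f i.
  exact: (bigID a).
have gE : map_poly iota g = \prod_(x <- l ++ s) ('X - x%:P).
  by rewrite eg prodE big_cat !big_map !big_filter.
have uratio i t : uu (b i ^+ j / p%:R ^+ e i) -> uu (b t ^+ j / p%:R ^+ e t) ->
    uu ((b i / b t) ^+ j / (p%:R ^+ e i / p%:R ^+ e t)).
  move=> ui ut; have := vunit_div ui ut.
  have rearr (A B C D : M) : (A / B) / (C / D) = (A / C) / (B / D).
    by rewrite !invf_div mulrACA [RHS]mulrACA [B^-1 * _]mulrC.
  by rewrite rearr expr_div_n.
have uv : uu ((iota g`_(size l)) / \prod_(y <- s) y).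
  rewrite -coef_map gE; apply: (coef_vertex_scaled valO (c := b i0)); first exact: b0.
    move=> x /mapP[i]; rewrite mem_filter => /andP[/eqP ai ir] ->.
    have := uratio _ _ (ub _ ir) (ub _ i0r); rewrite ai ei0 mulfV ?expf_neq0 // divr1.
    by move/(vunit_root valO j0)/andP => [].
  move=> x /mapP[i]; rewrite mem_filter => /andP[/= ai ir] ->.
  split; first exact: b0.
  have lt_em : (e i < m)%N by rewrite ltn_neqAle ai em.
  apply: (videal_root valO j0).
  have := uratio _ _ (ub _ i0r) (ub _ ir); rewrite ei0.
  rewrite -(subnK (ltnW lt_em)) exprD mulfK ?expf_neq0 // => /andP[Oq _].
  rewrite -(divfK (expf_neq0 (m - e i) pn0) ((_ / _) ^+ j)).
  by rewrite videalMl // videalX ?subn_gt0 ?videal_p.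
have g0 : iota g`_0 = (-1) ^+ size r * \prod_(i <- r) b i.
  by rewrite -coef_map eg; have := coef0_prod_XsubC (map b r); rewrite !big_map size_map.
pose q := g`_0 / g`_(size l).
have uq : uu (iota q ^+ j / p%:R ^+ (m * size l)).
  have lE : \prod_(i <- r | a i) b i = \prod_(x <- l) x by rewrite big_map big_filter.
  have sE : \prod_(i <- r | predC a i) b i = \prod_(x <- s) x by rewrite big_map big_filter.
  rewrite fmorph_div g0 prodE lE sE.
  set x := iota _ in uv *; set y := \prod_(x <- s) x in uv *.
  set z := \prod_(x <- l) x; set u := (-1) ^+ _.
  have y0 : y != 0 by rewrite prodf_seq_neq0; apply/allP => t /mapP[i];
    rewrite mem_filter => /andP[_ ir] ->; rewrite /= b0.
  have x0 : x != 0 by move/vunit_neq0: uv; apply: contraNneq => ->; rewrite mul0r.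
  have -> : u * (z * y) / x = u / (x / y) * z by field; rewrite x0 y0.
  rewrite exprMn -mulrA; apply: vunitM.
    by rewrite vunitX // vunit_div // vunitX // vunitN vunit1.
  rewrite /z exprM -prodrXl.
  have -> : (p%:R ^+ m) ^+ size l = \prod_(x <- l) p%:R ^+ m :> M.
    by rewrite big_const_seq iter_mulr_1 count_predT.
  rewrite -prodf_div.
  apply: vunit_prod => t /mapP[i]; rewrite mem_filter => /andP[/eqP ai ir] ->.
  by rewrite -ai; exact: ub.
have q0 : q != 0.
  by apply: contraTneq uq => ->; rewrite rmorph0 expr0n gtn_eqF // mul0r; apply/negP => /vunit_neq0; rewrite eqxx.
have [c [d ud]] := vunit_rat q0.
rewrite -szl; have /vp_inj : uu (p%:R ^+ (m * size l + c * j) / p%:R ^+ (d * j)).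
  have := vunit_div (vunitX j ud) uq.
  rewrite expr_div_n exprMn -!exprM.
  set A := iota q ^+ j; set B := p%:R ^+ (c * j); set C := p%:R ^+ (d * j).
  have A0 : A != 0 by rewrite expf_neq0 // fmorph_eq0.
  rewrite exprD -/B (_ : A * B / C / (A / _) = p%:R ^+ (m * size l) * B / C) //.
  by rewrite invf_div mulrACA; field; rewrite A0 expf_neq0.
by move=> E; rewrite -(dvdn_addl _ (dvdn_mull c (dvdnn j))) E dvdn_mull.
Qed.

End PadicValuationRing.

(** * Laguerre polynomials *)

Definition lagc (k a j : nat) : nat :=
  ('C(k, j) * \prod_(j.+1 <= i < k.+1) (i + a))%N.

(* The monic multiple [(-1)^k k! L_k] of the Laguerre polynomial. *)
Definition mlag (R : nzRingType) (k a : nat) : {poly R} :=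
  \poly_(j < k.+1) ((-1) ^+ (k - j) * (lagc k a j)%:R).

Lemma lagc_lead k a : lagc k a k = 1%N.
Proof. by rewrite /lagc binn big_geq. Qed.

Lemma lagc_gt0 k a j : (j <= k)%N -> (0 < lagc k a j)%N.
Proof.
move=> jk; rewrite muln_gt0 bin_gt0 jk big_nat; apply: prodn_cond_gt0 => i /andP[ji _].
by rewrite addn_gt0 (leq_trans _ ji).
Qed.

Lemma lagcS k a j : (j < k)%N ->
  (lagc k a j * (k - j) = lagc k a j.+1 * (j.+1 * (j.+1 + a)))%N.
Proof.
move=> jk; rewrite /lagc [in LHS]big_ltn ?ltnS //.
have := mul_bin_left k j; set A := 'C(k, j.+1); set B := 'C(k, j) => e.
by rewrite mulnAC [(B * _)%N]mulnC -e; nia.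
Qed.

Lemma bin_lagc0 k a i : (i <= k)%N ->
  ('C(k, i) * lagc k a 0 = lagc k a i * \prod_(1 <= m < i.+1) (m + a))%N.
Proof.
move=> ik; rewrite /lagc bin0 mul1n (big_cat_nat (n := i.+1)) //= -mulnA.
by congr (_ * _)%N; rewrite mulnC.
Qed.

Lemma dvdn_lagc p k a j l : (p %| j + a -> l < j <= k -> p %| lagc k a l)%N.
Proof.
move=> pj /andP[lj jk]; rewrite dvdn_mull // (big_cat_nat (n := j)) //=; last by apply: leqW.
by rewrite dvdn_mull // big_ltn ?ltnS // dvdn_mulr.
Qed.

Lemma size_mlag (R : nzRingType) k a : size (mlag R k a) = k.+1.
Proof. by rewrite size_poly_eq // subnn mul1r lagc_lead oner_neq0. Qed.

Lemma mlag_monic (R : nzRingType) k a : mlag R k a \is monic.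
Proof.
by rewrite monicE /lead_coef size_mlag coef_poly ltnSn subnn mul1r lagc_lead.
Qed.

Lemma map_mlag (R S : nzRingType) (f : {rmorphism R -> S}) k a :
  map_poly f (mlag R k a) = mlag S k a.
Proof.
apply/polyP => i; rewrite coef_map /= !coef_poly; case: ifP => _.
  by rewrite rmorphM rmorphXn rmorphN1 rmorph_nat.
by rewrite rmorph0.
Qed.

Lemma laguerreE k a :
  laguerre k a%:R = ((-1) ^+ k / k`!%:R) *: mlag rat k a.
Proof.
apply/polyP => j; rewrite coefZ !coef_poly; case: ltnP => jk; last by rewrite mulr0.
rewrite ltnS in jk; rewrite /lagc [in RHS]natrM natr_prod.
have -> : \prod_(j.+1 <= i < k.+1) (i + a)%:R = \prod_(j.+1 <= i < k.+1) (i%:R + a%:R) :> rat.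
  by apply: eq_bigr => i _; rewrite natrD.
set P := \prod_(_ <= _ < _) _.
have s1 : (-1) ^+ k * (-1) ^+ (k - j) = (-1) ^+ j :> rat.
  by rewrite -exprD -signr_odd -[RHS]signr_odd oddD oddB //; case: (odd k); case: (odd j).
have f0 n : n`!%:R != 0 :> rat by rewrite pnatr_eq0 -lt0n fact_gt0.
have e : 'C(k, j)%:R * (j`!%:R * (k - j)`!%:R) = k`!%:R :> rat.
  by rewrite -!natrM bin_fact.
rewrite -s1 natrM -e; field.
by rewrite !f0 pnatr_eq0 -lt0n bin_gt0.
Qed.

(** The Laguerre equation differentiated n times; for n = 0 it is the coefficient recursion [lagcS].
    The difference k - n is taken in the ring, so n may exceed k. *)
Lemma mlag_ode (R : comNzRingType) k a n (f := mlag R k a) :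
  'X * f^`(n.+2) + ((a.+1 + n)%:R - 'X) * f^`(n.+1) + (k%:R - n%:R) * f^`(n) = 0.
Proof.
elim: n => [|n IH].
  rewrite addn0 subr0; apply/polyP => j; rewrite coef0 !coefD mulrBl coefB.
  rewrite !coefXM -!polyC_natr !coefCM !derivnS derivn0 !coef_deriv.
  have fE i : (i <= k)%N -> f`_i = (-1) ^+ (k - i) * (lagc k a i)%:R.
    by move=> ik; rewrite coef_poly ltnS ik.
  have f0 i : (k < i)%N -> f`_i = 0.
    by move=> ik; rewrite coef_poly ltnS leqNgt ik.
  have fS : (j.+1 * (j.+1 + a))%:R * f`_j.+1 + (k%:R - j%:R) * f`_j = 0 :> R.
    case: (ltngtP j k) => jk.
    - rewrite !fE ?(ltnW jk) // -natrB ?(ltnW jk) //.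
      rewrite (_ : (k - j = (k - j.+1).+1)%N); last by lia.
      rewrite exprS mulN1r; set s := (-1) ^+ _.
      have := congr1 (fun t => t%:R : R) (lagcS a jk).
      rewrite (_ : (k - j = (k - j.+1).+1)%N); last by lia.
      rewrite natrM [in RHS]natrM => e; rewrite mulrCA [_ * (lagc k a j.+1)%:R]mulrC -e.
      by ring.
    - by rewrite !f0 ?mulr0 ?addr0 // ltnW.
    - by rewrite jk subrr mul0r addr0 f0 ?mulr0.
  case: j fS => [|j] fS /=; rewrite -[RHS]fS; move: (f`_ _) => y.
    by rewrite mul1n -[a.+1]add1n; ring.
  move: (f`_ _) => z; rewrite -!(mulr_natr y) -(mulr_natr z) -(mulr_natr (y * _)).
  by rewrite natrM natrD -[a.+1]addn1 natrD -(addn1 j.+1) natrD; ring.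
have := congr1 deriv IH; rewrite deriv0 !derivD !derivM !derivB derivX.
rewrite -!polyC_natr !derivC !polyC_natr -!derivnS => <-.
rewrite addnS -(natr1 (a.+1 + n)%N) -(natr1 n); ring.
Qed.

Lemma ndvd_fact p k : prime p -> (k < p)%N -> ~~ (p %| k`!)%N.
Proof.
move=> p_pr; elim: k => [|k IH] kp.
  by rewrite fact0 dvdn1; apply: contraTneq p_pr => ->.
by rewrite factS Euclid_dvdM // negb_or IH ?(ltnW kp) // gtnNdvd.
Qed.

Lemma ndvd_bin p k j : prime p -> (k < p)%N -> (j <= k)%N -> ~~ (p %| 'C(k, j))%N.
Proof.
move=> p_pr kp jk; apply: contra (ndvd_fact p_pr kp) => H.
by rewrite -(bin_fact jk) dvdn_mulr.
Qed.

Lemma ndvd_prod p m n (F : nat -> nat) : prime p ->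
  (forall i, m <= i < n -> ~~ (p %| F i))%N -> ~~ (p %| \prod_(m <= i < n) F i)%N.
Proof.
move=> p_pr H; rewrite big_nat; elim/big_ind: _ => //.
  by rewrite dvdn1; apply: contraTneq p_pr => ->.
by move=> x y nx ny; rewrite Euclid_dvdM // negb_or nx.
Qed.

Lemma ndvd_shift p k a i j : (k < p -> p %| j + a -> i != j -> 0 < i <= k ->
  0 < j <= k -> ~~ (p %| i + a))%N.
Proof.
move=> kp pj ij ik jk; apply/negP => pi.
wlog lt_ij : i j pi pj ij ik jk / (i < j)%N.
  move=> H; have [lt|lt|e] := ltngtP i j; first exact: (H i j).
    by apply: (H j i) => //; rewrite eq_sym.
  by rewrite e eqxx in ij.
have : (p %| (j + a) - (i + a))%N by rewrite dvdn_sub.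
by rewrite subnDr gtnNdvd ?subn_gt0 //; lia.
Qed.

(** Since p > k, the factor j + a is the only one divisible by p. This gives the vertices (0, 1) and
    (j, 0) of the Newton polygon. *)
Lemma good_lagc p k a j : prime p -> (k < p)%N -> (0 < j <= k)%N ->
  (p %| j + a)%N -> ~~ (p ^ 2 %| j + a)%N ->
  ~~ (p %| lagc k a j)%N /\ exists2 u, lagc k a 0 = (p * u)%N & ~~ (p %| u)%N.
Proof.
move=> p_pr kp jk pj p2j; have p0 := prime_gt0 p_pr.
have [j0 lejk] := andP jk.
have nd i : (i != j -> 0 < i <= k -> ~~ (p %| i + a))%N.
  by move=> ij ik; exact: (ndvd_shift kp pj ij ik jk).
have ndR : ~~ (p %| \prod_(j.+1 <= i < k.+1) (i + a))%N.
  apply: ndvd_prod => // i /andP[ji ik]; apply: nd; lia.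
have ndL : ~~ (p %| \prod_(1 <= i < j) (i + a))%N.
  apply: ndvd_prod => // i /andP[ji ik]; apply: nd; lia.
split; first by rewrite Euclid_dvdM // negb_or ndvd_bin.
exists (\prod_(1 <= i < j) (i + a) * (((j + a) %/ p) * \prod_(j.+1 <= i < k.+1) (i + a)))%N.
  rewrite /lagc bin0 mul1n (big_cat_nat (n := j)) //=; last by apply: leqW.
  rewrite (big_ltn (m := j)) ?ltnS // -{1}(divnK pj).
  by set L := (\prod_(_ <= _ < j) _)%N; rewrite [RHS]mulnCA; congr (_ * _)%N; rewrite mulnAC mulnC.
rewrite !Euclid_dvdM // !negb_or ndL ndR andbT /=.
by apply: contra p2j; rewrite dvdn_divRL // expnS expn1.
Qed.

(** * Roots of Laguerre polynomials under the extended valuation *)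

Section LaguerreRoots.
Variables (M : fieldType) (iota : {rmorphism rat -> M}) (p : nat).
Variables (O : subringClosed M).
Hypothesis p_pr : prime p.
Hypothesis valO : forall x, (x \in O) || (x^-1 \in O).
Hypothesis Op : p%:R^-1 \notin O.
Local Notation mm := (videal O).
Local Notation uu := (vunit O).
Let pn0 : p%:R != 0 :> M.
Proof. by rewrite (natr_neq0 iota) ?prime_gt0. Qed.

Lemma polyOver_mlag k a : mlag M k a \is a polyOver O.
Proof.
apply/polyOverP => i; rewrite coef_poly; case: ifP => _; last exact: rpred0.
by rewrite rpredM ?rpred_nat // rpredX // rpredN rpred1.
Qed.

Lemma mlag_root_valring k a x : root (mlag M k a) x -> x \in O.
Proof. exact: (integral_valring valO (mlag_monic _ _ _) (polyOver_mlag _ _)). Qed.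

Lemma mlag_rootE k a x : root (mlag M k a) x ->
  \sum_(0 <= i < k.+1) (-1) ^+ (k - i) * (lagc k a i)%:R * x ^+ i = 0.
Proof.
move=> /eqP; rewrite horner_coef size_mlag big_mkord => {2}<-.
by apply: eq_bigr => i _; rewrite coef_poly ltn_ord.
Qed.

(* If [p > k] divides [j + a] exactly once, the Newton polygon at [p] has slope
   [1/j] on a segment of length [j] and is flat elsewhere. *)
Lemma good_prime_roots k a j x : (k < p)%N -> (0 < j <= k)%N ->
  (p %| j + a)%N -> ~~ (p ^ 2 %| j + a)%N -> root (mlag M k a) x ->
  uu (x ^+ j / p%:R ^+ (x \in mm)).
Proof.
move=> kp jk pj p2j rx; have [ncj [u c0E nu]] := good_lagc p_pr kp jk pj p2j.
have [j0 lejk] := andP jk.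
have Ox := mlag_root_valring rx.
have [mx|nmx] := boolP (x \in mm); last first.
  by rewrite expr0 divr1 vunitX // /vunit Ox.
rewrite expr1; pose t i : M := (-1) ^+ (k - i) * (lagc k a i)%:R * x ^+ i.
have tE : \sum_(0 <= i < k.+1) t i = 0 := mlag_rootE rx.
have usign n : uu ((-1) ^+ n) by rewrite vunitX // vunitN vunit1.
have Osign n : (-1) ^+ n \in O by case/andP: (usign n).
rewrite (big_cat_nat (n := j)) //= in tE; last by apply: leqW.
(* Terms below j carry a factor p and the others a factor x^j. As x is in the ideal, both cofactors
   are units because their first terms are, and the equation reads x^j B = - p A. *)
pose A := (-1) ^+ k * u%:R + \sum_(1 <= i < j) (-1) ^+ (k - i) * (lagc k a i %/ p)%:R * x ^+ i.
pose B := (-1) ^+ (k - j) * (lagc k a j)%:R +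
  \sum_(j.+1 <= i < k.+1) (-1) ^+ (k - i) * (lagc k a i)%:R * x ^+ (i - j).
have AE : \sum_(0 <= i < j) t i = p%:R * A.
  rewrite big_ltn // mulrDr; congr (_ + _).
    by rewrite /t subn0 expr0 mulr1 c0E natrM mulrCA.
  rewrite mulr_sumr big_nat [RHS]big_nat; apply: eq_bigr => i /andP[i0 ij].
  have pc : (p %| lagc k a i)%N by apply: dvdn_lagc pj _; rewrite ij.
  by rewrite /t -{1}(divnK pc) natrM; ring.
have BE : \sum_(j <= i < k.+1) t i = x ^+ j * B.
  rewrite big_ltn ?ltnS // mulrDr; congr (_ + _); first by rewrite /t mulrC.
  rewrite mulr_sumr big_nat [RHS]big_nat; apply: eq_bigr => i /andP[ji ik].
  have -> : t i = (-1) ^+ (k - i) * (lagc k a i)%:R * (x ^+ j * x ^+ (i - j)).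
    by rewrite -exprD subnKC // ltnW.
  by rewrite mulrCA.
have uA : uu A.
  apply: vunitDm => //; first by rewrite vunitM // (vunit_natr p_pr valO Op).
  apply: videal_sum => // i; rewrite mem_index_iota => /andP[i0 _].
  by apply: videalMl; rewrite ?rpredM ?rpred_nat // videalX.
have uB : uu B.
  apply: vunitDm => //; first by rewrite vunitM // (vunit_natr p_pr valO Op).
  apply: videal_sum => // i; rewrite mem_index_iota => /andP[i0 _].
  by apply: videalMl; rewrite ?rpredM ?rpred_nat // videalX ?subn_gt0.
move: tE; rewrite AE BE => /eqP; rewrite addrC addr_eq0 => /eqP e.
rewrite (_ : _ / _ = - (A / B)); first by rewrite vunitN vunit_div.
have B0 := vunit_neq0 uB.
by apply: (mulIf B0); rewrite mulrAC e mulNr [p%:R * A]mulrC mulfK // mulNr divfK.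
Qed.

(** The product of all roots is the constant term up to sign, of valuation 1, and each root in the
    ideal contributes 1/j to it. *)
Lemma good_prime_count k a j rs : (k < p)%N -> (0 < j <= k)%N ->
  (p %| j + a)%N -> ~~ (p ^ 2 %| j + a)%N ->
  mlag M k a = \prod_(x <- rs) ('X - x%:P) -> count (mem mm) rs = j.
Proof.
move=> kp jk pj p2j fE; have [ncj [u c0E nu]] := good_lagc p_pr kp jk pj p2j.
have ux x : x \in rs -> uu (x ^+ j / p%:R ^+ (x \in mm)).
  by move=> xr; apply: (good_prime_roots kp jk pj p2j); rewrite fE root_prod_XsubC.
have c0 : (-1) ^+ k * (p%:R * u%:R) = (-1) ^+ size rs * \prod_(x <- rs) x.
  by rewrite -coef0_prod_XsubC -fE coef_poly /= subn0 c0E natrM.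
have H : uu (\prod_(x <- rs) (x ^+ j / p%:R ^+ (x \in mm))).
  by apply: vunit_prod => x /ux.
apply: (vp_inj iota p_pr valO Op).
have -> : p%:R ^+ count (mem mm) rs / p%:R ^+ j =
  ((-1) ^+ size rs * (-1) ^+ k * u%:R) ^+ j *
   (\prod_(x <- rs) (x ^+ j / p%:R ^+ (x \in mm)))^-1.
  rewrite prodf_div prodrXl.
  have -> : \prod_(x <- rs) p%:R ^+ (x \in mm) = p%:R ^+ count (mem mm) rs :> M.
    elim: (rs) => [|x s IH]; first by rewrite big_nil.
    by rewrite big_cons IH -exprD.
  have -> : \prod_(x <- rs) x = (-1) ^+ size rs * (-1) ^+ k * (p%:R * u%:R).
    by rewrite -mulrA c0 mulrA -expr2 sqrr_sign mul1r.
  rewrite invf_div !exprMn.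
  set s1 := ((-1) ^+ size rs) ^+ j; set s2 := ((-1) ^+ k) ^+ j; set U := u%:R ^+ j.
  have s10 : s1 != 0 by rewrite !expf_neq0 // oppr_eq0 oner_eq0.
  have s20 : s2 != 0 by rewrite !expf_neq0 // oppr_eq0 oner_eq0.
  have U0 : U != 0.
    by rewrite expf_neq0 // (natr_neq0 iota) // lt0n; apply: contraNneq nu => ->.
  by field; rewrite s10 s20 U0 expf_neq0.
apply: vunitM; last by rewrite vunitV.
by rewrite vunitX // !vunitM // ?vunitX ?vunitN ?vunit1 // (vunit_natr p_pr valO Op).
Qed.

(* The constant term dominates all others at a root of valuation at least [1/d]. *)
Lemma no_small_root k a d x : (0 < d)%N ->
  (forall i, 0 < i <= k -> d * logn p (\prod_(1 <= m < i.+1) (m + a)) < i)%N ->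
  root (mlag M k a) x -> x ^+ d / p%:R \notin O.
Proof.
move=> d0 small rx; apply/negP => Oxd.
have := mlag_rootE rx; rewrite big_ltn // => /eqP; rewrite addr_eq0 => /eqP e.
have c0 : (lagc k a 0)%:R != 0 :> M by rewrite (natr_neq0 iota) // lagc_gt0.
have : \sum_(1 <= i < k.+1) (-1) ^+ (k - i) * (lagc k a i)%:R * x ^+ i / (lagc k a 0)%:R \in mm.
  apply: videal_sum => // i; rewrite mem_index_iota ltnS => /andP[i0 ik].
  set N := (\prod_(1 <= m < i.+1) (m + a))%N.
  have N0 : (0 < N)%N.
    by rewrite /N big_nat; apply: prodn_cond_gt0 => m /andP[m0 _]; lia.
  have N0' : N%:R != 0 :> M by rewrite (natr_neq0 iota).
  have Ei : (lagc k a i)%:R / (lagc k a 0)%:R = 'C(k, i)%:R / N%:R :> M.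
    apply/eqP; rewrite eqr_div // -!natrM; apply/eqP; congr (_%:R).
    by rewrite bin_lagc0.
  set s := (-1) ^+ _; have -> : s * (lagc k a i)%:R * x ^+ i / (lagc k a 0)%:R =
      s * 'C(k, i)%:R * (x ^+ i / N%:R).
    transitivity (s * ((lagc k a i)%:R / (lagc k a 0)%:R) * x ^+ i); first by ring.
    by rewrite Ei; ring.
  apply: videalMl; first by rewrite rpredM ?rpred_nat ?rpredX ?rpredN ?rpred1.
  (* Passing to d-th powers makes the exponents integral: x^(d i) is divisible by p^i, and N^d only
     involves p^(v d) with v d < i. *)
  apply: (videal_root valO d0).
  have uN := vunit_natr_part iota p_pr valO Op N0.
  set v := logn p N in uN; have lt_i : (v * d < i)%N by rewrite mulnC small ?i0.
  have -> : (x ^+ i / N%:R) ^+ d =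
     (x ^+ d / p%:R) ^+ i * (N%:R / p%:R ^+ v)^-1 ^+ d * p%:R ^+ (i - v * d).
    have pi : p%:R ^+ i = p%:R ^+ (i - v * d) * (p%:R ^+ v) ^+ d :> M.
      by rewrite -exprM -exprD subnK // ltnW.
    rewrite invf_div !expr_div_n pi (exprAC x).
    set P := p%:R ^+ (i - _); set Q := (p%:R ^+ v) ^+ d; set X := _ ^+ i.
    have P0 : P != 0 by rewrite expf_neq0.
    have Q0 : Q != 0 by rewrite !expf_neq0.
    by field; rewrite P0 Q0 expf_neq0.
  apply: videalMl.
    by rewrite rpredM ?rpredX //; move: uN; rewrite vunitE => /and3P[].
  by rewrite videalX ?subn_gt0 // videal_p.
rewrite -mulr_suml; set S := \sum_(_ <= _ < _) _ in e *.
have -> : S / (lagc k a 0)%:R = - (-1) ^+ k.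
  by apply: (mulIf c0); rewrite divfK // -[S]opprK -e subn0 expr0 mulr1 mulNr.
rewrite videalN; apply/negP.
by have /andP[] : uu ((-1) ^+ k) by rewrite vunitX // vunitN vunit1.
Qed.

(** The constant term of g is a rational in the ideal, hence divisible by p; were every root of
    valuation below 1/d, the product of the d roots would have valuation below 1. *)
Lemma large_root (sg : seq M) (g : {poly rat}) :
  map_poly iota g = \prod_(x <- sg) ('X - x%:P) ->
  {in sg, forall x, x \in O} -> has (mem mm) sg ->
  exists2 x, x \in sg & x ^+ size sg / p%:R \in O.
Proof.
move=> gE Os hs; set d := size sg.
have d0 : (0 < d)%N by rewrite /d; case: (sg) hs.
have mprod (s : seq M) : {in s, forall x, x \in O} -> has (mem mm) s -> \prod_(x <- s) x \in mm.
  elim: s => //= x s IH Oxs /orP[mx|hs']; rewrite big_cons.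
    by apply: videalMr => //; rewrite big_seq rpred_prod // => y ys; rewrite Oxs // inE ys orbT.
  apply: videalMl; first by rewrite Oxs // inE eqxx.
  by apply: IH => // y ys; rewrite Oxs // inE ys orbT.
have mg0 : iota g`_0 \in mm.
  rewrite -coef_map gE coef0_prod_XsubC; apply: videalMl; last exact: mprod.
  by rewrite rpredX // rpredN rpred1.
have Og0 := rat_videal_div p_pr valO Op mg0.
apply: contrapT => H.
have mx x : x \in sg -> p%:R / x ^+ d \in mm.
  move=> xs; rewrite videalE invf_div; apply/orP; right; apply/negP => Ox.
  by apply: H; exists x.
have x0 x : x \in sg -> x != 0.
  move=> xs; apply/eqP => x0; apply: H; exists x => //.
  by rewrite x0 expr0n gtn_eqF // mul0r rpred0.
have m1 : \prod_(x <- sg) (p%:R / x ^+ d) \in mm.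
  have := mprod [seq p%:R / x ^+ d | x <- sg]; rewrite big_map; apply.
    by move=> t /mapP[x xs ->]; apply: videal_sub => //; exact: mx.
  have [x xs _] := hasP hs.
  by rewrite has_map; apply/hasP; exists x => //=; exact: mx.
have : (iota g`_0 / p%:R) ^+ d * \prod_(x <- sg) (p%:R / x ^+ d) \in mm.
  by apply: videalMl => //; rewrite rpredX.
rewrite prodf_div prodrXl big_const_seq iter_mulr_1 count_predT -/d.
rewrite -expr_div_n -exprMn -coef_map gE coef0_prod_XsubC -/d.
have P0 : \prod_(x <- sg) x != 0 by rewrite prodf_seq_neq0; apply/allP => x /x0.
rewrite (_ : _ / p%:R * _ = (-1) ^+ d); last by field; rewrite pn0 P0.
apply/negP; by have /andP[] : uu (((-1) ^+ d) ^+ d) by rewrite !vunitX // vunitN vunit1.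
Qed.

(** At a unit x the leading coefficient of the Laguerre equation is invertible, which excludes
    multiple roots modulo the ideal. The case x = y is allowed and serves to show that the roots are
    distinct. *)
Lemma congruent_roots_in_ideal k a x y s : (k < p)%N ->
  mlag M k a = \prod_(z <- [:: x, y & s]) ('X - z%:P) ->
  x - y \in mm -> x \in mm.
Proof.
move=> kp fE mxy; set f := mlag M k a in fE.
have rx : root f x by rewrite fE root_prod_XsubC inE eqxx.
have Ox := mlag_root_valring rx.
have Os z : z \in s -> z \in O.
  by move=> zs; apply: (@mlag_root_valring k a); rewrite -/f fE root_prod_XsubC !inE zs !orbT.
apply: contraT => nmx; have uxx : uu x by rewrite /vunit Ox.
(* The differential equation propagates a double root modulo the ideal to all
   derivatives, down to the constant [k!]. *)
have md n : f^`(n).[x] \in mm /\ f^`(n.+1).[x] \in mm.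
  elim: n => [|n [IH1 IH2]].
    split; first by rewrite derivn0 (eqP rx) videal0.
    rewrite derivn1 fE !big_cons mulrA; set R := \prod_(_ <- _) _.
    rewrite (_ : _.[x] = (x - y) * R.[x]); last first.
      by rewrite derivM derivM !derivXsubC !hornerE /=; ring.
    apply: videalMr => //.
    rewrite rpred_horner //; apply: polyOver_prod_XsubC => z; exact: Os.
  split => //; have := congr1 (horner^~ x) (mlag_ode M k a n).
  rewrite -/f !hornerE -!polyC_natr !hornerE => e.
  have -> : f^`(n.+2).[x] = - x^-1 * ((a.+1 + n)%:R - x) * f^`(n.+1).[x]
      - x^-1 * (k%:R - n%:R) * f^`(n).[x].
    apply: (mulfI (vunit_neq0 uxx)); apply: subr0_eq; rewrite -[RHS]e.
    by field; rewrite (vunit_neq0 uxx).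
  have OxV : x^-1 \in O by have := uxx; rewrite vunitE => /and3P[].
  by rewrite videalD ?videalN // videalMl // rpredM ?rpredN ?rpredB ?rpred_nat.
have [] := md k; rewrite (_ : f^`(k) = (k`!%:R)%:P) ?hornerC; last first.
  apply/polyP => i; rewrite coef_derivn coefC.
  case: i => [|i] /=; first by rewrite addn0 coef_poly ltnSn subnn mul1r lagc_lead ffactnn.
  by rewrite nth_default ?mul0rn // size_mlag; lia.
by rewrite (videal_natr p_pr valO Op) // (negbTE (ndvd_fact p_pr kp)).
Qed.

End LaguerreRoots.

Definition has_simple_prime (k n : nat) : bool :=
  has (fun p => (k < p)%N && ~~ (p ^ 2 %| n)%N) (primes n).

Lemma has_simple_primeP k n : (0 < n)%N ->
  reflect (exists p, [/\ prime p, (k < p)%N, (p %| n)%N & ~~ (p ^ 2 %| n)%N])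
    (has_simple_prime k n).
Proof.
move=> n0; apply: (iffP hasP) => [[p]|[p [p_pr kp pn p2n]]].
  by rewrite mem_primes => /and3P[p_pr _ pn] /andP[kp p2n]; exists p.
by exists p; rewrite ?mem_primes ?p_pr ?n0 ?pn ?kp.
Qed.

(* The first condition forces any factor of degree [d] to have a root of positive
   valuation, hence one of valuation at least [1/d]; the second excludes this. *)
Definition newton_prime (k a d : nat) : Prop := exists2 p, prime p &
  (exists2 i, i < d & p %| k - i + a)%N /\
  (forall i, 0 < i <= k -> d * logn p (\prod_(1 <= m < i.+1) (m + a)) < i)%N.

Lemma mlag_no_factor k a d (g h : {poly rat}) :
  (0 < d)%N -> (d.*2 <= k)%N -> g \is monic -> h \is monic -> size g = d.+1 ->
  mlag rat k a = g * h ->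
  ((forall j, k - d < j <= k -> ~~ has_simple_prime k (j + a))%N -> newton_prime k a d) ->
  False.
Proof.
move=> d0 dk mg mh szg fE B.
have szh : size h = (k - d).+1.
  have := size_mlag rat k a; rewrite fE size_monicM ?monic_neq0 // szg; move: (size h) dk => s dk; rewrite addSn /=; lia.
have [sg gE] := closed_field_poly_normal (map_poly (ratr : rat -> algC) g).
have [sh hE] := closed_field_poly_normal (map_poly (ratr : rat -> algC) h).
rewrite lead_coef_map (monicP mg) rmorph1 scale1r in gE.
rewrite lead_coef_map (monicP mh) rmorph1 scale1r in hE.
have ssg : size sg = d.
  by apply: succn_inj; rewrite -(size_prod_XsubC _ id) -gE size_map_poly.
have ssh : size sh = (k - d)%N.
  by apply: succn_inj; rewrite -(size_prod_XsubC _ id) -hE size_map_poly.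
have FE : mlag algC k a = \prod_(x <- sg ++ sh) ('X - x%:P).
  by rewrite -(map_mlag (ratr : {rmorphism rat -> algC})) fE rmorphM /= gE hE big_cat.
have rootF x : x \in sg ++ sh -> root (mlag algC k a) x by rewrite FE root_prod_XsubC.
pose rtr : {rmorphism rat -> algC} := ratr.
have [p p_pr [[i id pi] small]] : newton_prime k a d.
  apply: B => j /andP[dj jk]; apply/negP.
  have ja0 : (0 < j + a)%N by lia.
  case/(has_simple_primeP _ ja0) => p [p_pr kp pj p2j].
  have [ O [Op valO]] := exists_valuation_ring rtr p_pr.
  have jk' : (0 < j <= k)%N by lia.
  have := good_prime_count rtr p_pr valO Op kp jk' pj p2j FE.
  (* A rational factor contains a multiple of j roots of the ideal. Both factors have degree below
     j, since d <= k - d < j, so neither contains any; yet there are j of them in total. *)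
  have part (s : seq algC) (f : {poly rat}) : map_poly rtr f = \prod_(x <- s) ('X - x%:P) ->
      {subset s <= sg ++ sh} -> (size s < j)%N -> count (mem (videal O)) s = 0%N.
    move=> sE ss lt_sj.
    have := @vertex_dvd _ rtr p O p_pr valO Op _ s id (fun x => x \in videal O) j 1 f.
    rewrite mul1n => /(_ _ sE) H.
    have {H} : (j %| count (mem (videal O)) s)%N.
      have -> : count (mem (videal O)) s = count (fun x => (x \in videal O) == 1%N :> nat) s.
        by apply: eq_count => x /=; case: (x \in videal O).
      apply: H; first by lia.
        move=> x xs; apply: (good_prime_roots rtr p_pr valO Op kp jk' pj p2j).
        by apply: rootF; exact: ss.
      by move=> x _; case: (x \in videal O).
    have lt : (count (mem (videal O)) s < j)%N by rewrite (leq_ltn_trans (count_size _ _)).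
    by case: (count _ _) lt => // n lt /dvdn_leq; lia.
  have cg : count (mem (videal O)) sg = 0%N.
    by apply: (part sg g gE) => [x|]; [rewrite mem_cat => -> | rewrite ssg; lia].
  have ch : count (mem (videal O)) sh = 0%N.
    by apply: (part sh h hE) => [x|]; [rewrite mem_cat orbC => -> | rewrite ssh; lia].
  by rewrite count_cat cg ch; lia.
have [ O [Op valO]] := exists_valuation_ring rtr p_pr.
have OF : {in sg ++ sh, forall x, x \in O}.
  by move=> x /rootF; exact: mlag_root_valring.
have hsg : has (mem (videal O)) sg.
  apply: (factor_root_in_ideal valO FE OF) => l; rewrite ssh => ld.
  rewrite coef_poly; case: ifP => _; last exact: videal0.
  apply: videalMl; first by rewrite rpredX // rpredN rpred1.
  rewrite (videal_natr p_pr valO Op); apply: dvdn_lagc pi _; lia.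
have Osg : {in sg, forall x, x \in O} by move=> x xs; apply: OF; rewrite mem_cat xs.
have [x xs] := large_root p_pr valO Op gE Osg hsg.
rewrite ssg; apply/negP.
apply: (no_small_root rtr p_pr valO Op d0 small).
by apply: rootF; rewrite mem_cat xs.
Qed.

Lemma laguerre_irreducible k a : (0 < k)%N ->
  (forall d, (0 < d)%N -> (d.*2 <= k)%N ->
    (forall j, k - d < j <= k -> ~~ has_simple_prime k (j + a))%N -> newton_prime k a d) ->
  irreducible_poly (laguerre k a%:R).
Proof.
move=> k0 H; have c0 : (-1) ^+ k / k`!%:R != 0 :> rat.
  by rewrite mulf_neq0 ?invr_eq0 ?signr_eq0 // pnatr_eq0 -lt0n fact_gt0.
have F0 : mlag rat k a != 0 by rewrite monic_neq0 ?mlag_monic.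
rewrite laguerreE; split; first by rewrite size_scale // size_mlag.
move=> q sq1; rewrite dvdpZr // => qF.
have q0 : q != 0 by apply: contraNneq F0 => q0; rewrite q0 dvd0p in qF.
have lq0 : lead_coef q != 0 by rewrite lead_coef_eq0.
pose g := (lead_coef q)^-1 *: q; pose h := mlag rat k a %/ g.
have gq : g %= q by rewrite /g eqp_scale // invr_eq0.
have mg : g \is monic by rewrite monicE lead_coefZ mulVf.
have fE : mlag rat k a = h * g by rewrite divpK // (eqp_dvdl _ gq).
have mh : h \is monic by rewrite -(monicMr _ mg) -fE mlag_monic.
apply: contraT => nq; exfalso.
have sg : (1 < size g)%N.
  rewrite ltn_neqAle eq_sym (eqp_size gq) sq1 lt0n size_poly_eq0 //.
have szs : (size h + size g = k.+2)%N.
  have := size_mlag rat k a; rewrite fE size_monicM ?monic_neq0 //.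
  by case: (_ + _)%N => //= n ->.
have sh : (1 < size h)%N.
  rewrite ltn_neqAle lt0n size_poly_eq0 monic_neq0 // andbT eq_sym.
  apply: contra nq => /eqP sh1.
  have h1 : h = 1.
    have := size1_polyC (eq_leq sh1); move/monicP: mh; rewrite /lead_coef sh1 /= => -> ->.
    by rewrite polyC1.
  by rewrite fE h1 mul1r eqp_sym (eqp_trans (eqp_scale _ c0)).
have main (f1 f2 : {poly rat}) : f1 \is monic -> f2 \is monic -> (1 < size f1)%N ->
    (size f1 <= size f2)%N -> (size f1 + size f2 = k.+2)%N -> mlag rat k a = f1 * f2 -> False.
  move=> m1 m2 s1 le s12 e; have s1E : size f1 = (size f1).-1.+1 by rewrite prednK // ltnW.
  have s10 : (0 < (size f1).-1)%N by rewrite -ltnS -s1E.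
  have s1k : ((size f1).-1.*2 <= k)%N.
    by move: (size f1) (size f2) le s12; clear => u v; lia.
  exact: (mlag_no_factor s10 s1k m1 m2 s1E e (H _ s10 s1k)).
case: (leqP (size g) (size h)) => [le|/ltnW le].
  by apply: (main g h); rewrite // 1?addnC // mulrC.
exact: (main h g).
Qed.

(** * Inertia and the Galois group *)

Section Inertia.
Variables (L : splittingFieldType rat) (E : {subfield L}) (O : subringClosed L).
Hypothesis valO : forall x, (x \in O) || (x^-1 \in O).
Local Notation mm := (videal O).
Local Notation G := ('Gal(E / 1%VS)%g).

(** A ring of p-integral elements that is stable under the Galois group, which [O] itself need not
    be. *)
Definition conj_integral (x : L) : Prop :=
  x \in E /\ forall s, s \in G -> s x \in O.

Lemma conj_integral_gal s x : s \in G -> conj_integral x -> conj_integral (s x).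
Proof.
move=> sG [xE Ox]; split; first exact: memv_gal.
by move=> t tG; rewrite -galM // Ox // groupM.
Qed.

Lemma conj_integralM x y : conj_integral x -> conj_integral y -> conj_integral (x * y).
Proof.
move=> [xE Ox] [yE Oy]; split; first exact: rpredM.
by move=> s sG; rewrite rmorphM rpredM ?Ox ?Oy.
Qed.

(* Dedekind's independence of characters, modulo the maximal ideal of [O]. *)
Lemma gal_independent_mod (c : gal_of E -> L) :
  (forall s, s \in G -> c s \in O) ->
  (forall x, conj_integral x -> \sum_(s in G) c s * s x \in mm) ->
  (forall s t, s \in G -> t \in G -> s != t ->
     exists2 x, conj_integral x & s x - t x \notin mm) ->
  forall s, s \in G -> c s \in mm.
Proof.
move=> Oc mc sep.
have [n] := ubnP #|[set s in G | c s \notin mm]|.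
elim: n c Oc mc => // n IH c Oc mc; rewrite ltnS => cn s sG.
apply: contraT => ns.
have [only|] := boolP [forall t in G, (t != s) ==> (c t \in mm)].
  have I1 : conj_integral 1 by split=> [|t _]; rewrite ?mem1v // rmorph1 rpred1.
  have := mc 1 I1; rewrite (bigD1 s) //= rmorph1 mulr1 => m1.
  have m2 : \sum_(t in G | t != s) c t * t 1 \in mm.
    rewrite -big_filter; apply: videal_sum => // t; rewrite mem_filter => /andP[/andP[tG ts] _].
    by rewrite rmorph1 mulr1; move/forall_inP: only => /(_ t tG)/implyP/(_ ts).
  by move: ns; rewrite -(addrK (\sum_(t in G | t != s) c t * t 1) (c s)) videalD ?videalN.
rewrite negb_forall_in => /exists_inP[t tG]; rewrite negb_imply => /andP[ts nt].
have st : s != t by rewrite eq_sym.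
have [b Ib nb] := sep s t sG tG st.
(* The relation for b x minus t b times the relation for x: the term of t disappears, and that of s
   survives because s b and t b differ modulo the ideal. *)
pose c' u := c u * (u b - t b).
have Ob u : u \in G -> u b \in O by case: Ib => _; apply.
have : c' s \in mm.
  apply: IH => //.
  - move=> u uG; by rewrite rpredM ?Oc // rpredB ?Ob.
  - move=> x Ix; have -> : \sum_(u in G) c' u * u x =
        \sum_(u in G) c u * u (b * x) - t b * \sum_(u in G) c u * u x.
      rewrite mulr_sumr -sumrB; apply: eq_bigr => u _.
      by rewrite /c' rmorphM /=; ring.
    by rewrite videalD ?videalN // ?videalMl ?Ob ?mc //; exact: conj_integralM.
  - apply: leq_trans cn; apply: proper_card; apply/properP; split.
      apply/fintype.subsetP => u; rewrite !inE => /andP[uG]; rewrite uG /=.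
      by apply: contra => mu; rewrite /c' mulrC videalMl // rpredB ?Ob.
    exists t; rewrite !inE ?tG ?nt //= negbK /c' subrr mulr0 //.
    exact: videal0.
have Ob' : s b - t b \in O by rewrite rpredB ?Ob.
by move=> /(videal_prime (Oc s sG) Ob'); rewrite (negbTE ns) (negbTE nb).
Qed.

(* If all characters [s mod videal] were distinct, some [Tr(x/w)] would have the
   valuation of [1/w], which is not that of a rational number. *)
Lemma nontrivial_inertia w : galois 1%VS E -> w \in E -> w != 0 ->
  (forall s, s \in G -> w / s w \in O) ->
  (forall q : rat, ~~ vunit O (q%:A * w)) ->
  exists s, [/\ s \in G, s != 1%g & forall x, conj_integral x -> s x - x \in mm].
Proof.
move=> galE wE w0 Ow nu; apply: contrapT => H.
have sep s t : s \in G -> t \in G -> s != t ->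
    exists2 x, conj_integral x & s x - t x \notin mm.
  move=> sG tG st; apply: contrapT => H2; apply: H; exists (t^-1 * s)%g; split.
  - by rewrite groupM ?groupV.
  - by apply: contra st => /eqP e; rewrite -(mul1g s) -(mulgV t) -mulgA e mulg1.
  - move=> x Ix; have Iy : conj_integral ((t^-1)%g x) by apply: conj_integral_gal; rewrite ?groupV.
    case: (Ix) => xE _; case: (Iy) => yE _.
    rewrite galM //; set y := (t^-1)%g x in Iy yE *.
    have -> : x = t y by rewrite -galM // mulVg gal_id.
    by apply: contrapT => ny; apply: H2; exists y => //; apply/negP.
have c1 : (1%g : gal_of E) \in G by apply: group1.
have [y Iy ny] : exists2 y, conj_integral y & \sum_(s in G) w / s w * s y \notin mm.
  apply: contrapT => H2.
  have : w / (1%g : gal_of E) w \in mm.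
    apply: (gal_independent_mod (c := fun s => w / s w)) => // y Iy.
    by apply: contrapT => /negP ny; apply: H2; exists y.
  by rewrite gal_id mulfV // (negbTE (videal1 _)).
have yE : y \in E by case: Iy.
have ywE : y / w \in E by rewrite rpred_div.
have /vlineP[q qE] := mem_galTrace galE ywE.
move/negP: (nu q); apply; rewrite -qE.
have -> : galTrace 1 E (y / w) * w = \sum_(s in G) w / s w * s y.
  rewrite /galTrace mulr_suml; apply: eq_bigr => s _.
  by rewrite fmorph_div mulrAC [RHS]mulrC mulrA.
rewrite /vunit ny andbT rpred_sum // => s sG.
by rewrite rpredM ?Ow //; case: Iy => _; apply.
Qed.

End Inertia.

(** An n by b multiplication table repeats at least n./2 * b./2 of its entries, so at least that
    many integers up to n b are missing from it and must be bad. *)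
Lemma sparse_mult_table (n b : nat) (bad : pred nat) :
  (forall j, 0 < j <= n * b -> ~~ bad j ->
    exists x y, [/\ 0 < x <= n, 0 < y <= b & j = x * y])%N ->
  (n./2 * b./2 <= count bad (iota 1 (n * b)))%N.
Proof.
move=> H; pose rng m := iota 1 m.
have in_rng m x : (x \in rng m) = (0 < x <= m)%N by rewrite mem_iota add1n ltnS.
(* [(2x, y)] and [(x, 2y)] have the same product; only the latter is kept. *)
pose dup (u : nat * nat) := ~~ odd u.1 && (u.2.*2 <= b)%N.
pose prs := [seq (x, y) | x <- rng n, y <- rng b].
have in_prs x y : ((x, y) \in prs) = (0 < x <= n)%N && (0 < y <= b)%N.
  apply/allpairsP/andP => [[[u v] /= [ux vy [-> ->]]]|[xr yr]].
    by rewrite -!in_rng.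
  by exists (x, y); split; rewrite ?in_rng.
have uprs : uniq prs.
  by apply: allpairs_uniq; rewrite ?iota_uniq // => -[? ?] [? ?] _ _ [-> ->].
have dups : (n./2 * b./2 <= count dup prs)%N.
  rewrite -size_filter -(size_iota 1 n./2) -(size_iota 1 b./2).
  rewrite -(size_allpairs (fun x y => (x.*2, y))); apply: uniq_leq_size.
    apply: allpairs_uniq; rewrite ?iota_uniq // => -[x y] [z t] _ _ /= [e ->].
    by rewrite (double_inj e).
  move=> _ /allpairsP[[x y] /= [xr yr ->]].
  rewrite mem_filter in_prs /dup /= odd_double /=.
  move: xr yr; rewrite -/(rng _) -/(rng _) !in_rng => /andP[x0 xn] /andP[y0 yb].
  have := leq_double x n./2; have := leq_double y b./2.
  have := odd_double_half n; have := odd_double_half b.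
  by rewrite xn yb => ? ? /esym ? /esym ?; lia.
pose good := [seq j <- rng (n * b) | ~~ bad j].
pose vals := [seq u.1 * u.2 | u <- prs & ~~ dup u]%N.
have repr m x y : (x <= m -> 0 < x <= n -> 0 < y <= b -> x * y \in vals)%N.
  elim: m x y => [|m IH] x y xm xr yr; first by lia.
  have [du|nd] := boolP (dup (x, y)); last first.
    by apply/mapP; exists (x, y) => //; rewrite mem_filter nd in_prs xr yr.
  case/andP: du => /= ox yb.
  have xE : x = x./2.*2 by rewrite -[LHS]odd_double_half (negbTE ox).
  have -> : (x * y = x./2 * y.*2)%N by rewrite {1}xE -!muln2; lia.
  by apply: IH; lia.
have szg : (size good <= size vals)%N.
  apply: uniq_leq_size; first by rewrite filter_uniq ?iota_uniq.
  move=> j; rewrite mem_filter in_rng => /andP[nb jr].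
  by have [x [y [xr yr ->]]] := H j jr nb; apply: (repr x).
have szv : size vals = (n * b - count dup prs)%N.
  have := count_predC dup prs; rewrite size_map size_filter size_allpairs !size_iota.
  by rewrite -/(predC dup) => <-; rewrite addKn.
have := count_predC bad (iota 1 (n * b)); rewrite size_iota.
have : (count dup prs <= n * b)%N.
  by rewrite (leq_trans (count_size _ _)) // size_allpairs !size_iota.
move: szg; rewrite szv size_filter -/(predC bad).
by move: dups; set u := count dup _; set w := count bad _; set v := count _ _; lia.
Qed.

(** Calling x and y related when their transposition lies in H gives an equivalence relation, which
    H preserves by conjugation. A single class makes H the full symmetric group; otherwise
    transitivity makes the classes equal in size, and the given transposition makes them
    nontrivial. *)
Lemma transposition_blocks (T : finType) (H : {group {perm T}}) (x0 y0 : T) :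
  (forall x y, exists2 s, s \in H & s x = y) -> x0 != y0 -> tperm x0 y0 \in H ->
  (forall s, s \in H) \/
  exists P b, [/\ finset.partition P [set: T]%SET, (1 < b)%N, (1 < #|P|)%N,
    forall B, B \in P -> #|B| = b &
    forall s B, s \in H -> B \in P -> s @: B \in P].
Proof.
move=> tr xy0 Hxy; pose R := [rel x y : T | tperm x y \in H].
have RE x y : R x y = (tperm x y \in H) by [].
have Rxx x : R x x by rewrite RE tperm1 group1.
have Rsym x y : R x y = R y x by rewrite !RE tpermC.
have Rtr x y z : R x y -> R y z -> R x z.
  rewrite !RE => Hxy' Hyz; have [->//|ne] := eqVneq x y.
  have [->|nz] := eqVneq z x; first by rewrite tperm1 group1.
  have [<-//|nyz] := eqVneq y z.
  have : (tperm x y ^ tperm y z)%g \in H by rewrite groupJ.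
  by rewrite tpermJ tpermL tpermD // 1?eq_sym.
have Req : {in [set: T]%SET & &, equivalence_rel R}.
  move=> x y z _ _ _; split=> [|xy]; first exact: Rxx.
  by apply/idP/idP; apply: Rtr; rewrite // Rsym.
have RJ s x y : s \in H -> R (s x) (s y) = R x y.
  by move=> sH; rewrite !RE -tpermJ groupJr.
pose P := equivalence_partition R [set: T]%SET.
have Pp : finset.partition P [set: T]%SET := finset.equivalence_partitionP Req.
have pbE x y : (y \in finset.pblock P x) = R x y.
  by rewrite (finset.pblock_equivalence_partition Req) ?inE.
have inP x : finset.pblock P x \in P.
  by rewrite finset.pblock_mem // (finset.cover_partition Pp) inE.
have PE B : B \in P -> exists x, B = finset.pblock P x.
  move=> BP; have /set0Pn[x xB] : B != finset.set0.
    by apply: contraTneq BP => ->; case/and3P: Pp.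
  exists x; apply/esym/finset.def_pblock => //; by case/and3P: Pp.
have sP s x : s \in H -> s @: finset.pblock P x = finset.pblock P (s x).
  move=> sH; apply/setP => y; rewrite pbE; apply/imsetP/idP => [[z]|].
    by rewrite pbE => xz ->; rewrite RJ.
  move=> sxy; exists (s^-1%g y); last by rewrite permKV.
  by rewrite pbE -(RJ _ _ _ sH) permKV.
have [|nall] := boolP [forall x, forall y, R x y].
  move=> all; left => s; have [ts -> _] := prod_tpermP s.
  apply: group_prod => t _; rewrite -RE.
  by move/forallP: all => /(_ t.1)/forallP/(_ t.2).
right; exists P, #|finset.pblock P x0|; split => //.
- rewrite (cardD1 x0) pbE Rxx /= (cardD1 y0) !inE eq_sym xy0 /= pbE RE Hxy //.
- move: nall; rewrite negb_forall => /existsP[x]; rewrite negb_forall => /existsP[y nR].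
  rewrite (cardD1 (finset.pblock P x)) inP /= (cardD1 (finset.pblock P y)) !inE inP andbT /=.
  suff -> : finset.pblock P y != finset.pblock P x by [].
  by apply: contra nR => /eqP e; rewrite -pbE -e pbE Rxx.
- move=> B /PE[x ->]; have [s sH <-] := tr x0 x.
  by rewrite -sP // card_imset //; exact: perm_inj.
- by move=> s B sH /PE[x ->]; rewrite sP.
Qed.

(** * The Galois group of a Laguerre polynomial *)

Section LaguerreGalois.
Variables (L : splittingFieldType rat) (E : {subfield L}) (k a : nat) (rs : seq L).
Hypothesis k2 : (2 < k)%N.
Hypothesis splitE : splittingFieldFor 1%VS (mlag L k a) E.
Hypothesis fE : mlag L k a = \prod_(x <- rs) ('X - x%:P).
Hypothesis irr : irreducible_poly (mlag rat k a).
Hypothesis good1 : has_simple_prime k (1 + a).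
Hypothesis good2 : has_simple_prime k (2 + a).
Local Notation G := ('Gal(E / 1%VS)%g).
Local Notation f := (mlag L k a).
Let emb : {rmorphism rat -> L} := in_alg L.

Lemma laguerre_size_roots : size rs = k.
Proof.
by apply: succn_inj; rewrite -(size_prod_XsubC _ id) -fE size_mlag.
Qed.

Lemma laguerre_rootsE x : root f x = (x \in rs).
Proof. by rewrite fE root_prod_XsubC. Qed.

Lemma laguerre_congruent p (O : subringClosed L) x y : prime p ->
  (forall x, (x \in O) || (x^-1 \in O)) -> p%:R^-1 \notin O -> (k < p)%N ->
  x \in rs -> y \in rs -> x != y -> x - y \in videal O -> x \in videal O.
Proof.
move=> p_pr valO Op kp xr yr xy; have yr' : y \in rem x rs.
  by rewrite (perm_mem (perm_to_rem xr)) inE eq_sym (negbTE xy) in yr.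
apply: (congruent_roots_in_ideal emb p_pr valO Op (k := k) (a := a) (s := rem y (rem x rs))) => //.
rewrite fE; apply: perm_big; apply: (perm_trans (perm_to_rem xr)).
by rewrite perm_cons perm_to_rem.
Qed.

(** For j = 1 exactly one root lies in the ideal, counted with multiplicity. A repeated root is
    congruent to another root, so it would lie in the ideal and count twice. *)
Lemma laguerre_uniq_roots : uniq rs.
Proof.
have a1 : (0 < 1 + a)%N by [].
have [p [p_pr kp pa p2a]] := has_simple_primeP k a1 good1.
have [ O [Op valO]] := exists_valuation_ring emb p_pr.
have k1 : (0 < 1 <= k)%N by lia.
have cnt := good_prime_count emb p_pr valO Op kp k1 pa p2a fE.
have dup (s : seq L) : ~~ uniq s -> exists x t, perm_eq s [:: x, x & t].
  elim: s => //= x s IH; rewrite negb_and negbK => /orP[xs|/IH[y [t st]]].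
    by exists x, (rem x s); rewrite perm_cons perm_to_rem.
  exists y, (x :: t); rewrite -(perm_cons x) in st; apply: (perm_trans st).
  by rewrite (perm_catCA [:: x] [:: y; y] t).
apply: contraT => /dup[x [t st]].
have mx : x \in videal O.
  apply: (congruent_roots_in_ideal emb p_pr valO Op kp (a := a) (y := x) (s := t)).
    by rewrite fE; exact: perm_big.
  by rewrite subrr videal0.
by move: cnt; rewrite (seq.permP st) /= mx.
Qed.

Lemma laguerre_gal_root s x : s \in G -> x \in rs -> s x \in rs.
Proof.
move=> sG; rewrite -!laguerre_rootsE.
by rewrite -{2}(map_mlag (s : {rmorphism L -> L})) fmorph_root.
Qed.

Lemma laguerre_adjoin : <<1 & rs>>%VS = E.
Proof.
have [ss fss EE] := splitE.
have eqss x : (x \in rs) = (x \in ss).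
  by rewrite -laguerre_rootsE -(root_prod_XsubC ss) (eqp_root fss).
rewrite -EE; apply/eqP; rewrite eqEsubv.
by apply/andP; split; apply: adjoin_seqSr => x; rewrite eqss.
Qed.

Lemma laguerre_roots_memv x : x \in rs -> x \in E.
Proof. by move=> xr; rewrite -laguerre_adjoin seqv_sub_adjoin. Qed.

Lemma laguerre_galois_ext : galois 1%VS E.
Proof.
apply/splitting_galoisField; exists f; split => //.
  by rewrite -(map_mlag emb) alg_polyOver.
by rewrite fE separable_prod_XsubC laguerre_uniq_roots.
Qed.

Lemma laguerre_gal_perm s : s \in G ->
  exists t : {perm 'I_(size rs)}, forall i : 'I_(size rs), s rs`_i = rs`_(t i).
Proof.
move=> sG.
have lt (i : 'I_(size rs)) : (index (s rs`_i)%R rs < size rs)%N.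
  by rewrite index_mem laguerre_gal_root ?mem_nth.
pose h i := Ordinal (lt i).
have hE i : rs`_(h i) = s rs`_i by rewrite nth_index // laguerre_gal_root ?mem_nth.
have h_inj : injective h.
  move=> i j /(congr1 (fun i : 'I_(size rs) => rs`_i)); rewrite !hE => /fmorph_inj e.
  by apply: val_inj; apply/eqP; rewrite -(nth_uniq 0 _ _ laguerre_uniq_roots) ?ltn_ord // e.
by exists (perm h_inj) => i; rewrite permE hE.
Qed.

Definition realized (t : {perm 'I_(size rs)}) : Prop :=
  exists2 s, s \in G & forall i : 'I_(size rs), s rs`_i = rs`_(t i).

Let realset : {set {perm 'I_(size rs)}} := [set t | `[< realized t >]]%SET.

Lemma realsetP t : reflect (realized t) (t \in realset).
Proof. by rewrite inE; exact: asboolP. Qed.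

Lemma real_group_set : group_set realset.
Proof.
apply/group_setP; split=> [|t u /realsetP[s sG st] /realsetP[r rG ru]]; apply/realsetP.
  by exists 1%g; rewrite ?group1 // => i; rewrite gal_id perm1.
exists (s * r)%g; first exact: groupM.
by move=> i; rewrite galM ?laguerre_roots_memv ?mem_nth // st ru permM.
Qed.

Lemma laguerre_transitive i j : exists2 t, t \in realset & t i = j.
Proof.
pose x := rs`_i; pose y := rs`_j.
have xr : x \in rs by rewrite mem_nth. have yr : y \in rs by rewrite mem_nth.
have f1 : f \is a polyOver 1%VS by rewrite -(map_mlag emb) alg_polyOver.
have rx : root f x by rewrite laguerre_rootsE.
have := minPoly_dvdp f1 rx; have /polyOver1P[q qE] := minPolyOver 1%VS x.
rewrite qE -(map_mlag emb) dvdp_map => qf.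
have sq : size q != 1.
  have := size_minPoly 1%VS x; rewrite qE size_map_poly => ->.
  by rewrite eqSS /adjoin_degree.
have eqf := (irr.2 q sq qf).
have ry : root (minPoly 1%VS x) y.
  rewrite qE -(eqp_root (_ : map_poly emb (mlag rat k a) %= _)); last first.
    by rewrite eqp_map eqp_sym.
  by rewrite map_mlag laguerre_rootsE.
have /and3P[le1E _ nE] := laguerre_galois_ext.
have [s sG sx] := normalField_root_minPoly le1E nE (laguerre_roots_memv xr) ry.
have [t tE] := laguerre_gal_perm sG; exists t; first by apply/realsetP; exists s.
apply: val_inj; apply/eqP.
by rewrite -(nth_uniq 0 _ _ laguerre_uniq_roots) ?ltn_ord // -tE; exact/eqP.
Qed.

Lemma laguerre_transposition : exists i j : 'I_(size rs), i != j /\ tperm i j \in realset.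
Proof.
have a2 : (0 < 2 + a)%N by [].
have [p [p_pr kp pa p2a]] := has_simple_primeP k a2 good2.
have [ O [Op valO]] := exists_valuation_ring emb p_pr.
have k2' : (0 < 2 <= k)%N by lia.
have cnt := good_prime_count emb p_pr valO Op kp k2' pa p2a fE.
have urs := laguerre_uniq_roots.
have rootP z : z \in rs -> vunit O (z ^+ 2 / p%:R ^+ (z \in videal O)).
  move=> zr; apply: (good_prime_roots emb p_pr valO Op kp k2' pa p2a).
  by rewrite laguerre_rootsE.
have Ors z : z \in rs -> z \in O.
  by rewrite -laguerre_rootsE; exact: mlag_root_valring.
have z0 z : z \in rs -> z != 0.
  move=> /rootP/vunit_neq0; apply: contraNneq => ->.
  by rewrite expr0n mul0r.
have [x [y [xr yr xy [mx my] Jxy]]] : exists x y, [/\ x \in rs, y \in rs, x != y,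
    x \in videal O /\ y \in videal O & forall z, z \in rs -> z \in videal O -> z = x \/ z = y].
  have := filter_uniq (mem (videal O)) urs; have := cnt; rewrite -size_filter.
  have mf z : z \in seq.filter (mem (videal O)) rs = (z \in videal O) && (z \in rs).
    by rewrite mem_filter.
  move: mf; case: (seq.filter _ _) => [|x [|y [|? ?]]] // mf _ /=.
  rewrite inE andbT => xy; exists x, y.
  have := mf x; rewrite inE eqxx => /esym/andP[mx xr].
  have := mf y; rewrite !inE eqxx orbT => /esym/andP[my yr].
  split => // z zr mz; have := mf z; rewrite mz zr !inE /=.
  by case/orP=> /eqP->; [left|right].
have pn0 : p%:R != 0 :> L by rewrite (natr_neq0 emb) // prime_gt0.
(* The witness is [x], of valuation 1/2: its conjugates have valuation 1/2 or 0, so each [x / s x]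
   is integral, and no rational multiple of [x] is a unit. *)
have [] := nontrivial_inertia valO laguerre_galois_ext (laguerre_roots_memv xr) (z0 x xr).
- move=> s sG; have sxr := laguerre_gal_root sG xr.
  have [ms|ns] := boolP (s x \in videal O).
    have : vunit O ((x / s x) ^+ 2).
      have := vunit_div (rootP _ xr) (rootP _ sxr); rewrite mx ms expr1.
      by rewrite invf_div mulrA divfK // expr_div_n.
    by move/(vunit_root valO (isT : (0 < 2)%N))/andP => [].
  apply: rpredM; first exact: Ors.
  have : vunit O (s x) by rewrite /vunit ns Ors.
  by rewrite vunitE => /and3P[].
- move=> q; apply/negP => uq.
  have q0 : q != 0.
    by apply: contraTneq uq => ->; rewrite scale0r mul0r; apply/negP => /vunit_neq0; rewrite eqxx.
  have [c [d ud]] := vunit_rat emb p_pr valO Op q0.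
  (* Squaring reduces the claim to parity: an even and an odd power of p would agree up to a
     unit. *)
  have := vunit_div (vunitX 2 ud) (vunit_div (vunitX 2 uq) (rootP _ xr)).
  rewrite mx expr1 -[emb q]/(q%:A).
  have q1 : q%:A != 0 :> L by rewrite scaler_eq0 negb_or q0 oner_eq0.
  have -> : (q%:A * p%:R ^+ c / p%:R ^+ d) ^+ 2 / ((q%:A * x) ^+ 2 / (x ^+ 2 / p%:R)) =
      p%:R ^+ (c * 2) / p%:R ^+ (d * 2 + 1) :> L.
    rewrite exprD !exprM expr1; field.
    by rewrite q1 pn0 (z0 _ xr) andbT expf_neq0.
  move/(@vp_inj _ emb p O p_pr valO Op (c * 2) (d * 2 + 1)); clear; lia.
move=> s [sG s1 Is].
have conjI z : z \in rs -> conj_integral E O z.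
  move=> zr; split; first exact: laguerre_roots_memv.
  by move=> t tG; apply: Ors; exact: laguerre_gal_root.
have sz z : z \in rs -> s z - z \in videal O by move=> /conjI; exact: Is.
have sfix z : z \in rs -> z \notin videal O -> s z = z.
  move=> zr nz; apply/esym/eqP; apply: contraNT nz => ne.
  apply: (laguerre_congruent p_pr valO Op kp zr (laguerre_gal_root sG zr) ne).
  by rewrite -videalN opprB sz.
have sm z : z \in rs -> z \in videal O -> s z = x \/ s z = y.
  move=> zr mz; apply: Jxy; first exact: laguerre_gal_root.
  by rewrite -(subrK z (s z)) videalD // sz.
have sxy : s x = y.
  have [sx|//] := sm x xr mx; exfalso.
  have sy : s y = y.
    have [sy|//] := sm y yr my.
    by have /fmorph_inj e : s x = s y; [rewrite sx sy | rewrite e eqxx in xy].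
  move/negP: s1; apply; apply/gal_eqP => e eE; rewrite gal_id.
  have : (E <= fixedSpace s)%VS.
    apply: (subv_trans (_ : E <= <<1 & rs>>)%VS); first by rewrite laguerre_adjoin subvv.
    apply/Fadjoin_seqP; split; first exact: sub1v.
    move=> z zr; apply/fixedSpaceP.
    have [mz|nz] := boolP (z \in videal O); last exact: sfix.
    by have [->|->] := Jxy z zr mz.
  by move/subvP/(_ e eE)/fixedSpaceP.
have syx : s y = x.
  have [//|sy] := sm y yr my.
  by have /fmorph_inj e : s x = s y; [rewrite sxy sy | rewrite e eqxx in xy].
have ix : (index x rs < size rs)%N by rewrite index_mem.
have iy : (index y rs < size rs)%N by rewrite index_mem.
exists (Ordinal ix), (Ordinal iy); split.
  by rewrite -val_eqE /=; apply: contra xy => /eqP e; rewrite -(nth_index 0 xr) e nth_index.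
apply/realsetP; exists s => // i; case: tpermP => [->|->|/eqP ni /eqP nj].
- by rewrite /= !nth_index.
- by rewrite /= !nth_index.
apply: sfix; first by rewrite mem_nth.
apply/negP => mi; have ir : rs`_i \in rs by rewrite mem_nth.
have [e|e] := Jxy _ ir mi.
  by move/eqP: ni; apply; apply: val_inj; rewrite /= -e index_uniq.
by move/eqP: nj; apply; apply: val_inj; rewrite /= -e index_uniq.
Qed.

(* The products of the roots over the blocks are the roots of a rational
   polynomial, so the Newton polygon of the latter has integral vertices. *)
Lemma laguerre_blocks (P : {set {set 'I_(size rs)}}) b j :
  finset.partition P [set: 'I_(size rs)]%SET ->
  (forall B, B \in P -> #|B| = b) ->
  (forall t B, t \in realset -> B \in P -> t @: B \in P) ->
  (0 < j <= k)%N -> has_simple_prime k (j + a) ->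
  exists x y, [/\ 0 < x <= #|P|, 0 < y <= b & j = x * y]%N.
Proof.
move=> Pp Pb Pt jk; have ja0 : (0 < j + a)%N by lia.
case/(has_simple_primeP _ ja0) => p [p_pr kp pj p2j].
have [ O [Op valO]] := exists_valuation_ring emb p_pr.
have cnt := good_prime_count emb p_pr valO Op kp jk pj p2j fE.
have rootP z : z \in rs -> vunit O (z ^+ j / p%:R ^+ (z \in videal O)).
  move=> zr; apply: (good_prime_roots emb p_pr valO Op kp jk pj p2j).
  by rewrite laguerre_rootsE.
pose be (B : {set 'I_(size rs)}) := \prod_(i in B) rs`_i.
pose g := \prod_(B in P) ('X - (be B)%:P).
have gfix s : s \in G -> map_poly s g = g.
  move=> sG; have [t tE] := laguerre_gal_perm sG.
  have tr : t \in realset by apply/realsetP; exists s.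
  rewrite /g rmorph_prod /=.
  transitivity (\prod_(B in P) ('X - (be (t @: B))%:P)).
    apply: eq_bigr => B _; rewrite rmorphB /= map_polyX map_polyC /=; congr ('X - _%:P).
    rewrite /be rmorph_prod big_imset /=; last by move=> ? ? _ _; exact: perm_inj.
    by apply: eq_bigr => i _; exact: tE.
  have ti : injective (fun B : {set 'I_(size rs)} => t @: B).
    exact: imset_inj perm_inj.
  rewrite -(big_imset (fun B => 'X - (be B)%:P)) /=; last by move=> ? ? _ _; exact: ti.
  suff -> : (fun B : {set 'I_(size rs)} => t @: B) @: P = P by [].
  apply/eqP; rewrite eqEcard card_imset // leqnn andbT.
  by apply/fintype.subsetP => _ /imsetP[C CP ->]; exact: Pt.
have [g0 gE] : exists g0, g = map_poly (in_alg L) g0.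
  apply/polyOver1P/polyOverP => n.
  have gnE : g`_n \in E.
    apply/polyOverP: n; rewrite rpred_prod // => B _.
    rewrite rpredB ?polyOverX ?polyOverC // rpred_prod // => i _.
    by rewrite laguerre_roots_memv // mem_nth.
  have fF : fixedField 'Gal(E / 1%VS)%g = 1%VS by apply/galois_fixedField/laguerre_galois_ext.
  rewrite -fF; apply/fixedFieldP => // s sG.
  by rewrite -coef_map gfix.
(* The product [be B] has valuation e B / j. *)
pose e (B : {set 'I_(size rs)}) := (\sum_(i in B) ((rs`_i)%R \in videal O))%N.
have eb B : B \in P -> (e B <= b)%N.
  move=> BP; rewrite -(Pb B BP) -sum1_card; apply: leq_sum => i _.
  by case: (_ \in _).
have sume : (\sum_(B in P) e B)%N = j.
  have tP : finset.trivIset P by case/and3P: Pp.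
  rewrite -(finset.big_trivIset _ tP) /= (finset.cover_partition Pp).
  rewrite -cnt -sum1_count (big_nth 0) big_mkord [RHS]big_mkcond /=.
  by apply: eq_big => i; rewrite ?inE // => _; case: (_ \in _).
pose m := \max_(B in P) e B.
have em B : B \in P -> (e B <= m)%N by move=> BP; exact: leq_bigmax_cond.
have [j0 _] := andP jk.
have [B0 B0P] : exists B, B \in P.
  apply/set0Pn; apply: contraTneq j0 => P0; rewrite -sume P0 big_set0 //.
have [B1 B1P mE] : exists2 B, B \in P & m = e B.
  have P0 : (0 < #|P|)%N by rewrite (cardD1 B0) B0P.
  by have [B BP mB] := eq_bigmax_cond e P0; exists B.
pose n := count (fun B => e B == m) (enum P).
have jmn : (j %| m * n)%N.
  apply: (@vertex_dvd L emb p O p_pr valO Op _ (enum P) be e j m g0) => //.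
  - by rewrite -[map_poly _ _]gE /g big_enum.
  - move=> B _; rewrite /be /e -prodrXl.
    rewrite (big_morph (fun n => p%:R ^+ n) (exprD p%:R) (expr0 p%:R)) -prodf_div.
    rewrite -big_enum; apply: vunit_prod => i _.
    by apply: rootP; rewrite mem_nth.
  - by move=> B; rewrite mem_enum; exact: em.
have n0 : (0 < n)%N.
  rewrite -has_count; apply/hasP; exists B1; rewrite ?mem_enum //.
  by rewrite mE.
have nP : (n <= #|P|)%N by rewrite cardE count_size.
(* The n blocks of maximal weight m hold m n of the j roots in the ideal, so the divisibility j %| m
   n is an equality. *)
have mn_le : (m * n <= j)%N.
  rewrite -sume -big_enum /n -sum1_count big_distrr /= big_mkcond /=.
  by apply: leq_sum => B _; case: eqP => // ->; rewrite muln1.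
have m0 : (0 < m)%N.
  rewrite lt0n; apply: contraTneq j0 => m0; rewrite -sume big1 // => B BP.
  by apply/eqP; rewrite -leqn0 -m0 em.
have jE : j = (m * n)%N.
  by apply/eqP; rewrite eqn_leq mn_le dvdn_leq // muln_gt0 m0.
exists n, m; split; rewrite ?n0 ?m0 ?nP //= 1?mulnC //.
by rewrite mE eb.
Qed.

Lemma laguerre_realized :
  (9 * count (fun j => ~~ has_simple_prime k (j + a)) (iota 1 k) < k)%N ->
  forall t, realized t.
Proof.
move=> few t; apply/realsetP.
have [i0 [j0 [ij0 Ht]]] := laguerre_transposition.
have [all|[P [b [Pp b1 P1 Pb Pt]]]] :=
  @transposition_blocks _ (Group real_group_set) i0 j0 laguerre_transitive ij0 Ht.
  exact: all.
have kE : (k = #|P| * b)%N.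
  by rewrite -(card_uniform_partition Pb Pp) cardsT card_ord laguerre_size_roots.
have := @sparse_mult_table #|P| b (fun j => ~~ has_simple_prime k (j + a)).
rewrite -kE => /(_ _)/wrap[j jk /negPn gj|le].
  exact: (laguerre_blocks Pp Pb Pt jk gj).
(* Source of the factor 9: both n and b are at least 2, so halving with rounding loses at most a
   factor 3 in each. *)
have half3 n : (1 < n -> n <= 3 * n./2)%N by lia.
have := leq_mul (half3 _ P1) (half3 _ b1); rewrite -kE.
have -> : (3 * #|P|./2 * (3 * b./2) = 9 * (#|P|./2 * b./2))%N by rewrite mulnACA.
rewrite leqNgt => /negP[]; apply: leq_ltn_trans few; by rewrite leq_mul2l.
Qed.

End LaguerreGalois.

Lemma has_simple_prime_leq k l n : (k <= l)%N ->
  has_simple_prime l n -> has_simple_prime k n.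
Proof.
move=> kl /hasP[p pn /andP[lp p2n]]; apply/hasP; exists p => //.
by rewrite (leq_ltn_trans kl lp).
Qed.

Lemma laguerre_galois_Sym k a : (2 < k)%N ->
  irreducible_poly (laguerre k a%:R) ->
  has_simple_prime k (1 + a) -> has_simple_prime k (2 + a) ->
  (9 * count (fun j => ~~ has_simple_prime k (j + a)) (iota 1 k) < k)%N ->
  galois_group_is_Sym (laguerre k a%:R).
Proof.
move=> k2 irr g1 g2 few L E rs.
set c := (-1) ^+ k / k`!%:R : rat.
have c0 : c != 0.
  by rewrite mulf_neq0 ?invr_eq0 ?signr_eq0 // pnatr_eq0 -lt0n fact_gt0.
have cA0 : c%:A != 0 :> L by rewrite scaler_eq0 negb_or c0 oner_eq0.
have lE : laguerre k a%:R = c *: mlag rat k a by rewrite laguerreE.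
have mE : map_poly (in_alg L) (laguerre k a%:R) = c%:A *: mlag L k a.
  by rewrite lE map_polyZ /= (map_mlag (in_alg L : {rmorphism rat -> L})).
have lc : lead_coef (laguerre k a%:R) = c.
  by rewrite lE lead_coefZ (monicP (mlag_monic _ _ _)) mulr1.
rewrite mE lc => spl /(scalerI cA0) fE.
have splE : splittingFieldFor 1%VS (mlag L k a) E.
  case: spl => ss fss EE; exists ss => //.
  by apply: eqp_trans fss; rewrite eqp_sym eqp_scale.
have irr' : irreducible_poly (mlag rat k a).
  case: irr; rewrite lE size_scale // => s1 H; split => // q sq qf.
  have : q %= c *: mlag rat k a by apply: H => //; rewrite dvdpZr.
  by move/eqp_trans; apply; rewrite eqp_scale.
move=> t; exact: (laguerre_realized k2 splE fE irr' g1 g2 few).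
Qed.

(** Requiring primes above [K] rather than above [k] only makes more integers bad, so one set of
    conditions serves every k up to [K]. *)
Lemma good_alpha_criterion K a :
  (forall k, 0 < k <= K ->
     9 * count (fun j => ~~ has_simple_prime K (j + a)) (iota 1 k) < k)%N ->
  (forall k d, (k <= K)%N -> (0 < d)%N -> (d.*2 <= k)%N ->
     (forall j, k - d < j <= k -> ~~ has_simple_prime K (j + a))%N ->
     newton_prime k a d) ->
  good_alpha K a.
Proof.
move=> few newt k /andP[k8 kK].
(* Fewer than j / 9 bad integers up to j < 3 means none; thus 1 and 2 are good. *)
have good j : (0 < j < 3)%N -> has_simple_prime k (j + a).
  move=> j3; apply: (has_simple_prime_leq kK); apply: contraT => bad.
  have jK : (0 < j <= K)%N by lia.
  have : (0 < count (fun j => ~~ has_simple_prime K (j + a)) (iota 1 j))%N.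
    by rewrite -has_count; apply/hasP; exists j; rewrite // mem_iota; lia.
  by move: (few j jK); lia.
have irr : irreducible_poly (laguerre k a%:R).
  apply: laguerre_irreducible => [|d d0 dk bad]; first by lia.
  apply: newt => // j jk; apply: contra (bad j jk); exact: has_simple_prime_leq.
split => //; apply: laguerre_galois_Sym => //; try by [lia | apply: good].
apply: leq_ltn_trans (few k _); last by lia.
rewrite leq_mul2l /=; apply: sub_count => j; apply: contra; exact: has_simple_prime_leq.
Qed.

(** * Logarithmic sums over primes *)

Lemma nat_factor B n : (0 < n < B)%N ->
  n = (\prod_(0 <= p < B | prime p && (p %| n)) p ^ logn p n)%N.
Proof.
move=> /andP[n0 nB]; have e := partnT n0; rewrite -{1}e /partn.
rewrite [RHS](big_cat_nat (n := n.+1)) //= [X in _ = (_ * X)%N]big1_seq ?muln1; last first.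
  move=> p /andP[/andP[_ pn]]; rewrite mem_index_iota => /andP[np _].
  by move: (dvdn_leq n0 pn); lia.
rewrite [RHS]big_mkcond /=; apply: eq_big_nat => p _.
by case: ifP => // /negP H; rewrite lognE n0 /=; case: ifP => // /andP[pp pn]; case: H; rewrite pp.
Qed.

Section LogSums.
Variable R : realType.
Local Notation lnn n := (ln (n%:R : R)).

Lemma lnn_ge0 n : 0 <= lnn n.
Proof.
by case: n => [|n]; [rewrite ln0 | rewrite ln_ge0 // ler1n].
Qed.

Lemma ler_lnn m n : (0 < m)%N -> (m <= n)%N -> lnn m <= lnn n.
Proof.
move=> m0 mn; rewrite ler_ln ?posrE ?ltr0n ?ler_nat //; exact: leq_trans mn.
Qed.

Lemma lnnM m n : (0 < m)%N -> (0 < n)%N -> lnn (m * n) = lnn m + lnn n.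
Proof. by move=> m0 n0; rewrite natrM lnM // posrE ltr0n. Qed.

Lemma lnnX m e : (0 < m)%N -> lnn (m ^ e) = e%:R * lnn m.
Proof. by move=> m0; rewrite natrX lnXn ?ltr0n // mulr_natl. Qed.

Lemma lnn_prod (I : eqType) (r : seq I) (P : pred I) (F : I -> nat) :
  (forall i, i \in r -> P i -> (0 < F i)%N) ->
  lnn (\prod_(i <- r | P i) F i)%N = \sum_(i <- r | P i) lnn (F i).
Proof.
elim: r => [|x r IH] F0; first by rewrite !big_nil ln1.
have F0' : forall i, i \in r -> P i -> (0 < F i)%N.
  by move=> i ir; apply: F0; rewrite inE ir orbT.
rewrite !big_cons; case: ifP => Px; last exact: IH.
rewrite lnnM ?IH ?F0 ?inE ?eqxx //.
by rewrite big_seq_cond; apply: prodn_cond_gt0 => i /andP[ir Pi]; apply: F0'.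
Qed.

Lemma lnn_factor B n : (0 < n < B)%N ->
  lnn n = \sum_(0 <= p < B | prime p && (p %| n)%N) (logn p n)%:R * lnn p.
Proof.
move=> nB; rewrite {1}(nat_factor nB).
rewrite lnn_prod; last by move=> p _ /andP[pp _]; rewrite expn_gt0 prime_gt0.
by apply: eq_bigr => p /andP[pp _]; rewrite lnnX // prime_gt0.
Qed.

Lemma sum_ln_primes_dvd B n (Q : pred nat) : (0 < n < B)%N ->
  \sum_(0 <= p < B | [&& prime p, (p %| n)%N & Q p]) lnn p <= lnn n.
Proof.
move=> nB; rewrite (lnn_factor nB) big_mkcond [leRHS]big_mkcond /=.
apply: ler_sum => p _; case: (boolP (prime p)) => //= pp.
case: (boolP (p %| n)%N) => //= pn; have vn : (1 <= logn p n)%N.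
  by rewrite -pfactor_dvdn // ?expn1 //; case/andP: nB.
case: ifP => _; last by rewrite mulr_ge0 ?lnn_ge0.
by rewrite ler_peMl ?lnn_ge0 // ler1n.
Qed.

Lemma sum_exchange_dvd (B N : nat) (P : pred nat) (h : nat -> nat) (w : nat -> R) :
  \sum_(1 <= i < N.+1) \sum_(0 <= p < B | P p && (h p %| i)%N) w p =
  \sum_(0 <= p < B | P p) (N %/ h p)%:R * w p.
Proof.
under eq_bigr => i _ do rewrite big_mkcondr.
rewrite exchange_big /=; apply: eq_bigr => p _.
rewrite -big_mkcond /= -big_filter big_const_seq iter_addr_0 count_predT.
rewrite size_filter -sum1_count divn_count_dvd mulr_natl; congr (_ *+ _).
rewrite big_mkcond /=.
by apply: eq_bigr => i _; case: (_ %| _)%N.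
Qed.

(** For p <= K one has K / p <= 2 (K %/ p), and the sum of (K %/ p) log p is the sum over i <= K of
    the logarithms of the primes dividing i, each inner sum being at most log i. *)
Lemma sum_ln_prime_div K : (0 < K)%N ->
  \sum_(0 <= p < K.+1 | prime p) lnn p / p%:R <= 2 * lnn K.
Proof.
move=> K0; have K0' : 0 < K%:R :> R by rewrite ltr0n.
rewrite -(ler_pM2l K0') mulr_sumr.
apply: (@le_trans _ _ (2 * \sum_(0 <= p < K.+1 | prime p) (K %/ p)%:R * lnn p)).
  rewrite mulr_sumr big_nat_cond [leRHS]big_nat_cond.
  apply: ler_sum => p /andP[/andP[_ pK] pp]; have p0 := prime_gt0 pp.
  rewrite [leLHS]mulrCA [leLHS]mulrC [leRHS]mulrA ler_wpM2r ?lnn_ge0 //.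
  rewrite ler_pdivrMr ?ltr0n // -!natrM ler_nat.
  have := divn_eq K p; have := ltn_mod K p; rewrite p0 => r e.
  have : (0 < K %/ p)%N by rewrite divn_gt0 // -ltnS.
  nia.
rewrite -(@sum_exchange_dvd K.+1 K prime id) mulrCA ler_pM2l //.
apply: (@le_trans _ _ (\sum_(1 <= i < K.+1) lnn K)); last first.
  by rewrite sumr_const_nat subSS subn0 mulr_natl.
rewrite big_nat [leRHS]big_nat; apply: ler_sum => i /andP[i0 iK].
have iK' : (0 < i < K.+1)%N by rewrite i0.
apply: le_trans (ler_lnn i0 _); last by rewrite -ltnS.
have := sum_ln_primes_dvd xpredT iK'.
by under eq_bigl => p do rewrite andbT.
Qed.

Lemma sum_ln_primes_le N : \sum_(0 <= p < N.+1 | prime p) lnn p <= N%:R * lnn N.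
Proof.
apply: (@le_trans _ _ (\sum_(1 <= p < N.+1) lnn N)); last first.
  by rewrite sumr_const_nat subSS subn0 mulr_natl.
rewrite big_ltn_cond //= big_mkcond /= big_nat [leRHS]big_nat.
apply: ler_sum => p /andP[p0 pN].
by case: ifP => _; rewrite ?lnn_ge0 // ler_lnn.
Qed.

Lemma sum_ln_div_sqr N : \sum_(2 <= m < N) lnn m / (m ^ 2)%:R <= 2.
Proof.
(* Up to sign, (log t + 1) / t is a primitive of log t / t^2. The numerator log t + 2 absorbs the
   discretisation error, and the value at 1 is the bound 2. *)
pose g m : R := (lnn m + 2) / m%:R.
have step m : (0 < m)%N -> lnn m.+1 / (m.+1 ^ 2)%:R <= g m - g m.+1.
  move=> m0; have m0' : 0 < m%:R :> R by rewrite ltr0n.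
  have := lnn_ge0 m; rewrite /g; set x := (m%:R : R) in m0' *.
  have -> : m.+1%:R = x + 1 by rewrite -natr1.
  have -> : (m.+1 ^ 2)%:R = (x + 1) ^+ 2 :> R by rewrite natrX -natr1.
  have x1 : 1 <= x by rewrite ler1n.
  have lnS : ln (x + 1) <= ln x + x^-1.
    have -> : x + 1 = x * (1 + x^-1) by rewrite mulrDr mulr1 mulfV // gt_eqF.
    rewrite lnM ?posrE ?addr_gt0 ?invr_gt0 // lerD2l.
    by apply: le_ln1Dx; rewrite (lt_le_trans (ltrN10 R)) // invr_ge0 ltW.
  move: lnS; set L := ln x; set L1 := ln (x + 1) => lnS L0.
  have xV : x^-1 <= 1 by rewrite invf_le1.
  have xV0 : 0 < x^-1 by rewrite invr_gt0.
  have x10 : 0 < x + 1 by lra.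
  apply: (@le_trans _ _ ((L + 1) / (x * (x + 1)))).
    apply: (@le_trans _ _ ((L + 1) / ((x + 1) ^+ 2))).
      by rewrite ler_pM2r ?invr_gt0 ?exprn_gt0 //; lra.
    rewrite ler_wpM2l ?lef_pV2 ?posrE ?mulr_gt0 ?exprn_gt0 //; first lra.
    by rewrite expr2 ler_pM2r //; lra.
  have -> : (L + 1) / (x * (x + 1)) = (L + 2) / x - (L + x^-1 + 2) / (x + 1).
    by field; rewrite !gt_eqF.
  by rewrite lerD2l lerN2 ler_pM2r ?invr_gt0 //; lra.
have g0 m : 0 <= g m by rewrite divr_ge0 // addr_ge0 ?lnn_ge0.
have tele n : \sum_(2 <= m < n.+2) lnn m / (m ^ 2)%:R <= g 1%N - g n.+1.
  elim: n => [|n IH]; first by rewrite big_geq // subrr.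
  rewrite big_nat_recr //=; apply: le_trans (lerD IH (step n.+1 isT)) _.
  by rewrite addrA subrK.
have g1 : g 1%N = 2 by rewrite /g ln1 add0r divr1.
case: N => [|[|N]]; [by rewrite big_geq | by rewrite big_geq |].
by apply: le_trans (tele N) _; rewrite g1 gerBl.
Qed.

Lemma sum_inv_sqr Y N : (0 < Y)%N ->
  \sum_(Y.+1 <= s < N) (s ^ 2)%:R^-1 <= Y%:R^-1 :> R.
Proof.
move=> Y0; have tele n : \sum_(Y.+1 <= s < Y.+1 + n) (s ^ 2)%:R^-1 <= Y%:R^-1 - (Y + n)%:R^-1 :> R.
  elim: n => [|n IH]; first by rewrite !addn0 big_geq // subrr.
  rewrite addnS big_nat_recr ?leq_addr //=.
  suff : ((Y.+1 + n) ^ 2)%:R^-1 <= (Y + n)%:R^-1 - (Y + n.+1)%:R^-1 :> R by lra.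
  rewrite addnS addSn; set m := (Y + n)%N; have m0 : (0 < m)%N by rewrite addn_gt0 Y0.
  have m0' : 0 < m%:R :> R by rewrite ltr0n.
  rewrite natrX -natr1; set x := (m%:R : R) in m0' *.
  have -> : x^-1 - (x + 1)^-1 = (x * (x + 1))^-1.
    by field; rewrite !gt_eqF //; lra.
  have x10 : 0 < x + 1 by lra.
  rewrite lef_pV2 ?posrE ?mulr_gt0 ?exprn_gt0 // expr2 ler_pM2r //; lra.
have [le|lt] := leqP N Y.+1; first by rewrite big_geq // invr_ge0.
rewrite -(subnKC (ltnW lt)); apply: le_trans (tele _) _.
by rewrite lerBlDr lerDl invr_ge0.
Qed.

End LogSums.

(** For 0 < n < B, the largest integer whose square divides n. *)
Definition sqroot_part B n : nat :=
  (\prod_(0 <= p < B | prime p && (p %| n)) p ^ (logn p n)./2)%N.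

Lemma sqroot_part_dvd B n : (0 < n < B)%N -> (sqroot_part B n ^ 2 %| n)%N.
Proof.
move=> nB; rewrite {2}(nat_factor nB) /sqroot_part.
rewrite -[(_ ^ 2)%N]mulnn -big_split /=.
apply/dvdnP; exists (\prod_(0 <= p < B | prime p && (p %| n)) p ^ odd (logn p n))%N.
rewrite -big_split /=; apply: eq_bigr => p _.
by rewrite -!expnD addnn odd_double_half.
Qed.

(** If the exponent v is at least 2, then s = p^(v./2) is at most Y and v <= 3 (v./2), so p^v <= s^3
    <= Y^3 <= y^y <= p^y. *)
Lemma logn_bound p y Y N : prime p -> (0 < y <= p)%N -> (Y ^ 3 <= y ^ y)%N ->
  (0 < N)%N -> (forall s, s ^ 2 %| N -> s <= Y)%N -> (logn p N <= y)%N.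
Proof.
move=> pp /andP[y0 yp] Yy N0 sq.
have [le1|v2] := leqP (logn p N) 1; first exact: leq_trans y0.
set v := logn p N in v2 *; pose s := (p ^ v./2)%N.
have sY : (s <= Y)%N.
  by apply: sq; rewrite /s -expnM muln2 pfactor_dvdn //; rewrite -/v; lia.
rewrite -(leq_exp2l _ _ (prime_gt1 pp)).
apply: (@leq_trans (s ^ 3)); first by rewrite /s -expnM leq_exp2l ?prime_gt1 //; lia.
by apply: leq_trans (leq_trans Yy _); rewrite ?leq_exp2r.
Qed.

Lemma count_multiples q i a : (0 < q)%N ->
  (\sum_(1 <= m < i.+1) (q %| m + a) <= (i %/ q).+1)%N.
Proof.
move=> q0; have e1 : (\sum_(1 <= m < i.+1) (q %| m + a) =
    \sum_(a.+1 <= t < (i + a).+1) (q %| t))%N.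
  by rewrite -(add1n a) big_addn -addSn addnK.
have e2 := divn_count_dvd q (i + a); have e3 := divn_count_dvd q a.
rewrite (big_cat_nat (n := a.+1)) //= in e2; last by rewrite ltnS leq_addl.
rewrite -e3 divnD // in e2; rewrite e1.
by move: e2; case: (q <= _)%N => /=; lia.
Qed.

(** Up to i, the product has exponent at most A + y C, where A and C count the multiples of p and of
    p^2. The constants 4 and 8 make d A and d y C each less than i / 2: a count vanishes for small
    i, and beyond that the extra 1 in i %/ p + 1 is cheap. *)
Lemma newton_slopes k a d p y : prime p -> (0 < d)%N -> (4 * d < p)%N -> (0 < y <= p)%N ->
  (forall m, 0 < m <= k -> logn p (m + a) <= y)%N ->
  (forall m, 0 < m <= k -> m <= 4 * d -> ~~ (p %| m + a))%N ->
  (forall m, 0 < m <= k -> m <= 8 * d * y -> ~~ (p ^ 2 %| m + a))%N ->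
  (forall i, 0 < i <= k -> d * logn p (\prod_(1 <= m < i.+1) (m + a)) < i)%N.
Proof.
move=> pp d0 dp /andP[y0 yp] vy n1 n2 i /andP[i0 ik].
have p0 := prime_gt0 pp.
pose A := (\sum_(1 <= m < i.+1) (p %| m + a))%N.
pose C := (\sum_(1 <= m < i.+1) (p ^ 2 %| m + a))%N.
have logE : (logn p (\prod_(1 <= m < i.+1) (m + a)) <= A + y * C)%N.
  rewrite /A /C big_distrr -big_split /=.
  have -> : logn p (\prod_(1 <= m < i.+1) (m + a)) = (\sum_(1 <= m < i.+1) logn p (m + a))%N.
    elim: i {i0 ik A C} => [|i IH]; first by rewrite !big_geq // logn1.
    have -> : (\prod_(1 <= m < i.+2) (m + a) = (\prod_(1 <= m < i.+1) (m + a)) * (i.+1 + a))%N.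
      by rewrite big_nat_recr.
    rewrite [RHS]big_nat_recr //= lognM ?IH //.
    by rewrite big_nat; apply: prodn_cond_gt0 => m /andP[m0 _]; rewrite addn_gt0 m0.
  rewrite big_nat [leqRHS]big_nat; apply: leq_sum => m /andP[m0 mi].
  have mk : (0 < m <= k)%N by rewrite m0 (leq_trans _ ik).
  have ma0 : (0 < m + a)%N by rewrite addn_gt0 m0.
  have pv e : (p ^ e %| m + a)%N = (e <= logn p (m + a))%N by rewrite pfactor_dvdn.
  have := vy m mk; have := pv 1%N; rewrite expn1 pv => ->.
  by case: (logn p _) => [|[|v]] vy'; rewrite /= ?muln0 ?muln1 //; lia.
have A_le : (A <= (i %/ p).+1)%N by apply: count_multiples.
have C_le : (C <= (i %/ p ^ 2).+1)%N by apply: count_multiples; rewrite expn_gt0 p0.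
have ndiv (Q : nat -> bool) b : (forall m, 0 < m <= k -> m <= b -> ~~ Q (m + a))%N ->
    (i <= b)%N -> (\sum_(1 <= m < i.+1) Q (m + a))%N = 0%N.
  move=> nQ ib; rewrite big_nat big1 // => m /andP[m0 mi].
  by rewrite (negbTE (nQ m _ _)) //; lia.
have [i4|i4] := leqP i (4 * d).
  have A0 : A = 0%N := ndiv (dvdn p) _ n1 i4.
  have C0 : C = 0%N.
    by apply: (ndiv (dvdn (p ^ 2)) _ n2); apply: leq_trans i4 _; nia.
  by move: logE; rewrite A0 C0 muln0 leqn0 => /eqP->; rewrite muln0.
have dA : (2 * (d * A) < i)%N.
  have e := leq_divM i p; move: A_le e; set q := (i %/ p)%N => A_le e.
  have : (4 * d * q <= i)%N by apply: leq_trans e; rewrite mulnC leq_mul2l ltnW ?orbT.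
  nia.
have dC : (2 * (d * (y * C)) < i)%N.
  have [i8|i8] := leqP i (8 * d * y).
    by have -> : C = 0%N := ndiv (dvdn (p ^ 2)) _ n2 i8; rewrite !muln0.
  have e := leq_divM i (p ^ 2); move: C_le e; set q := (i %/ p ^ 2)%N => C_le e.
  have dy : (4 * d * y <= p ^ 2)%N by rewrite -mulnn leq_mul // ltnW.
  have : (4 * d * y * q <= i)%N by apply: leq_trans e; rewrite mulnC leq_mul2l dy orbT.
  nia.
have : (d * logn p (\prod_(1 <= m < i.+1) (m + a)) <= d * A + d * (y * C))%N.
  by rewrite -mulnDr leq_mul2l logE orbT.
by move: dA dC; lia.
Qed.

(** * A deterministic criterion for alpha *)

Section Typical.
Variable R : realType.
Local Notation lnn n := (ln (n%:R : R)).

(** The cut-off at B gives finite support, as the maximal inequality needs. *)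
Definition smooth_log K B i : R :=
  if (0 < i < B)%N then \sum_(0 <= p < K.+1 | prime p && (p %| i)%N) lnn p else 0.

Definition square_log B i : R :=
  if (0 < i < B)%N then \sum_(0 <= p < B | prime p && (p ^ 2 %| i)%N) lnn p else 0.

Lemma smooth_log_ge0 K B i : 0 <= smooth_log K B i.
Proof. by rewrite /smooth_log; case: ifP => // _; rewrite sumr_ge0 // => p _; exact: lnn_ge0. Qed.

Lemma square_log_ge0 B i : 0 <= square_log B i.
Proof. by rewrite /square_log; case: ifP => // _; rewrite sumr_ge0 // => p _; exact: lnn_ge0. Qed.

(** Let s^2 be the largest square divisor of N. An exponent v satisfies v <= 1 + 3 (v./2) always and
    v <= 3 (v./2) if v >= 2, which holds for all primes above K dividing N; so N is at most s^3
    times the product of its primes up to K. *)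
Lemma ln_not_simple K Y B N : (0 < N < B)%N -> (K < B)%N -> (0 < Y)%N ->
  (forall s, s ^ 2 %| N -> s <= Y)%N -> ~~ has_simple_prime K N ->
  lnn N <= smooth_log K B N + 3 * lnn Y.
Proof.
move=> NB KB Y0 sq bad; have N0 : (0 < N)%N by case/andP: NB.
have sqd := sqroot_part_dvd NB; set s := sqroot_part B N in sqd.
have s0 : (0 < s)%N.
  by rewrite lt0n; apply: contraTneq sqd => ->; rewrite exp0n // dvd0n -lt0n.
apply: (@le_trans _ _ (smooth_log K B N + 3 * lnn s)); last first.
  by rewrite lerD2l ler_pM2l // ler_lnn // sq.
rewrite /smooth_log NB (big_nat_widen _ _ B) //.
rewrite {1}(lnn_factor R NB) /s /sqroot_part lnn_prod; last first.
  by move=> p _ /andP[pp _]; rewrite expn_gt0 prime_gt0.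
rewrite mulr_sumr [X in X + _]big_mkcondr -big_split /=.
apply: ler_sum => p /andP[pp pN]; rewrite lnnX ?prime_gt0 // ltnS.
have l0 := lnn_ge0 R p.
have [pK|Kp] := leqP p K.
  have e : (logn p N)%:R <= 1 + 3 * (logn p N)./2%:R :> R.
    by rewrite -natrM nat1r ler_nat; have := odd_double_half (logn p N); lia.
  by have := ler_wpM2r l0 e; rewrite mulrDl mul1r mulrA.
rewrite add0r mulrA ler_wpM2r // -natrM ler_nat.
have p2 : (p ^ 2 %| N)%N.
  apply: contraT => p2; apply: contraNT bad => _; apply/(has_simple_primeP K N0).
  by exists p.
by rewrite pfactor_dvdn // in p2; have := odd_double_half (logn p N); lia.
Qed.

Lemma sum_nat_exchange (r : seq nat) B (P : pred nat) (Q : nat -> nat -> bool) (w : nat -> R) :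
  \sum_(j <- r) \sum_(0 <= p < B | P p && Q p j) w p =
  \sum_(0 <= p < B | P p) (\sum_(j <- r) Q p j)%:R * w p.
Proof.
under eq_bigr => i _ do rewrite big_mkcondr.
rewrite exchange_big /=; apply: eq_bigr => p _.
rewrite natr_sum mulr_suml; apply: eq_bigr => j _.
by case: (Q p j); rewrite ?mul1r ?mul0r.
Qed.

Lemma ler_sum_nat_subrange M N (P : pred nat) (Q : pred nat) (w : nat -> R) :
  (forall p, 0 <= w p) -> (forall p, Q p -> (p < N)%N) ->
  \sum_(0 <= p < M | P p && Q p) w p <= \sum_(0 <= p < N | P p) w p.
Proof.
move=> w0 QN; rewrite (big_nat_widen _ _ (maxn M N)) ?leq_maxl //.
rewrite [leRHS](big_nat_widen _ _ (maxn M N)) ?leq_maxr //.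
rewrite big_mkcond [leRHS]big_mkcond /=; apply: ler_sum => p _.
case: (P p) => //=; case: (boolP (Q p)) => [/QN->|_] /=; first by case: ifP.
by case: ifP.
Qed.

(** Here [l] stands for log x and [Y] bounds the square divisors. [H1] and [H2] come from the
    maximal inequality; [HA] serves the count of bad j, [HN] irreducibility. *)
Variables (K Y y B a : nat) (l c1 lam : R).
Hypotheses (K0 : (0 < K)%N) (Y0 : (0 < Y)%N) (y0 : (0 < y)%N) (a0 : (0 < a)%N).
Hypotheses (KaB : (K + a < B)%N).
Hypotheses (yY : (Y ^ 3 <= y ^ y)%N) (Yy : (y.-1 ^ y.-1 <= Y ^ 3)%N).
Hypotheses (c10 : 0 < c1) (lam0 : 0 <= lam).
Hypothesis H1 : forall d, \sum_(1 <= m < d.+1) smooth_log K B (m + a) <= c1 * d%:R.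
Hypothesis H2 : forall d, \sum_(1 <= m < d.+1) square_log B (m + a) <= lam * d%:R.
Hypothesis H3 : forall s j, (0 < j <= K)%N -> (s ^ 2 %| j + a)%N -> (s <= Y)%N.
Hypothesis H4 : l / 2 <= lnn a.
Hypothesis HA : 9 * c1 < l / 2 - 3 * lnn Y.
Hypothesis HN : 6 * lnn Y + 6 * lnn (2 * K) + 4 * c1 + 8 * (y%:R * lam) < l / 2.

Let inB j : (0 < j <= K)%N -> (0 < j + a < B)%N.
Proof. by lia. Qed.

Let KB : (K < B)%N. Proof. by lia. Qed.

Lemma bad_log_bounds j : (0 < j <= K)%N -> ~~ has_simple_prime K (j + a) ->
  l / 2 <= smooth_log K B (j + a) + 3 * lnn Y.
Proof.
move=> jK bad; apply: le_trans (ln_not_simple (inB jK) KB Y0 (fun s => H3 jK) bad).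
by apply: le_trans H4 _; rewrite ler_lnn // leq_addl.
Qed.

(** Each bad j contributes more than 9 c1 to a sum that [H1] bounds by c1 k. *)
Lemma typical_few_bad k : (0 < k <= K)%N ->
  (9 * count (fun j => ~~ has_simple_prime K (j + a)) (iota 1 k) < k)%N.
Proof.
move=> kK; set c := count _ _; have [->|c0] := posnP c; first by case/andP: kK.
rewrite -(ltr_nat R) natrM -(ltr_pM2l c10) mulrA [c1 * _]mulrC.
apply: (@lt_le_trans _ _ ((l / 2 - 3 * lnn Y) * c%:R)).
  by rewrite ltr_pM2r ?ltr0n.
apply: le_trans (H1 k); rewrite mulrC /c -sum1_count natr_sum mulr_suml.
rewrite -[X in \sum_(_ <- iota _ X | _) _](subn1 k.+1) -/(index_iota 1 k.+1).
rewrite big_mkcond big_seq [leRHS]big_seq; apply: ler_sum => j.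
rewrite mem_index_iota => /andP[j0 jk]; case: ifP => [bad|_]; last exact: smooth_log_ge0.
by rewrite mul1r lerBlDr bad_log_bounds //; lia.
Qed.

(** The d bad terms carry total logarithm at least d l / 2, up to squares. If no prime excluded the
    factor, the primes up to K could not supply that much, by [HN]. *)
Lemma typical_newton k d : (k <= K)%N -> (0 < d)%N -> (d.*2 <= k)%N ->
  (forall j, k - d < j <= k -> ~~ has_simple_prime K (j + a))%N ->
  newton_prime k a d.
Proof.
move=> kK d0 dk bad; apply: contrapT => nnewt.
have fail p i : prime p -> (4 * d < p)%N -> (y <= p)%N -> (i < d)%N ->
    (p %| k - i + a)%N ->
    (exists2 m, 0 < m <= minn (4 * d) k & p %| m + a)%N \/
    (exists2 m, 0 < m <= minn (8 * d * y) k & p ^ 2 %| m + a)%N.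
  move=> pp dp yp id pi; apply: contrapT => /not_orP[n1 n2]; apply: nnewt.
  exists p => //; split; first by exists i.
  apply: (newton_slopes pp d0 dp (y := y)); first by rewrite y0.
  - move=> m mk; apply: (logn_bound pp _ yY); rewrite ?y0 ?addn_gt0 ?a0 ?orbT //.
    by move=> s; apply: H3; case/andP: mk => -> mk; exact: leq_trans kK.
  - by move=> m mk md; apply/negP => pm; apply: n1; exists m => //; rewrite leq_min md; case/andP: mk => ->.
  - by move=> m mk md; apply/negP => pm; apply: n2; exists m => //; rewrite leq_min md; case/andP: mk => ->.
pose W := index_iota (k - d).+1 k.+1.
have memW j : j \in W -> (0 < j <= K)%N /\ (k - d < j <= k)%N.
  by rewrite mem_index_iota; clear -kK; lia.
have szW : size W = d by rewrite size_iota; clear -dk; lia.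
have S1 : l / 2 * d%:R <= \sum_(j <- W) (smooth_log K B (j + a) + 3 * lnn Y).
  apply: (@le_trans _ _ (\sum_(j <- W) l / 2)).
    by rewrite big_const_seq iter_addr_0 count_predT szW mulr_natr.
  rewrite big_seq [leRHS]big_seq; apply: ler_sum => j /memW[jK jkd].
  by apply: bad_log_bounds => //; exact: bad.
pose Np p := (\sum_(j <- W) (p %| j + a))%N.
have S2 : \sum_(j <- W) smooth_log K B (j + a) = \sum_(0 <= p < K.+1 | prime p) (Np p)%:R * lnn p.
  rewrite -sum_nat_exchange big_seq [RHS]big_seq; apply: eq_bigr => j /memW[jK _].
  by rewrite /smooth_log inB.
pose V1 := index_iota 1 (minn (4 * d) k).+1.
pose V2 := index_iota 1 (minn (8 * d * y) k).+1.
(* [T1] and [T2] account for the primes below [4d] and below [y]; the other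
   primes must also divide some [m + a] with [m] small, hence [T3] and [T4]. *)
pose T1 p : R := if (p <= 4 * d)%N then d%:R * (lnn p / p%:R) + lnn p else 0.
pose T2 p : R := if (p < y.-1.+1)%N then lnn p else 0.
pose T3 p : R := (\sum_(m <- V1) (p %| m + a)%N)%:R * lnn p.
pose T4 p : R := (\sum_(m <- V2) (p ^ 2 %| m + a)%N)%:R * lnn p.
have T0 p : [/\ 0 <= T1 p, 0 <= T2 p, 0 <= T3 p & 0 <= T4 p].
  have lp := lnn_ge0 R p; rewrite /T1 /T2 /T3 /T4.
  by split; try (case: ifP => // _); rewrite ?addr_ge0 ?mulr_ge0 ?invr_ge0.
have NpE p : (0 < p)%N -> (Np p <= (d %/ p).+1)%N.
  move=> p0; have := count_multiples d (k - d + a) p0; rewrite /Np /W.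
  have -> : (\sum_(1 <= m < d.+1) (p %| m + (k - d + a)) =
     \sum_((k - d).+1 <= j < k.+1) (p %| j + a))%N; last by [].
  rewrite -[(k - d).+1]add1n big_addn (_ : k.+1 - (k - d) = d.+1)%N; last by clear -dk; lia.
  by apply: eq_bigr => m _; rewrite addnA.
have S3 p : prime p -> (Np p)%:R * lnn p <= T1 p + T2 p + T3 p + T4 p.
  move=> pp; have [t1 t2 t3 t4] := T0 p; have lp := lnn_ge0 R p.
  have p0 := prime_gt0 pp; have Npp := NpE p p0.
  have [p4|p4] := leqP p (4 * d).
    suff : (Np p)%:R * lnn p <= T1 p by lra.
    have e : (Np p)%:R <= d%:R / p%:R + 1 :> R.
      apply: (@le_trans _ _ ((d %/ p).+1%:R)); first by rewrite ler_nat.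
      by rewrite -natr1 lerD2r ler_pdivlMr ?ltr0n // -natrM ler_nat leq_divM.
    by have := ler_wpM2r lp e; rewrite /T1 p4 mulrDl mul1r -mulrA [_^-1 * _]mulrC.
  have dp : (d < p)%N by clear -p4; lia.
  have {}Npp : (Np p <= 1)%N by move: Npp; rewrite divn_small.
  have [->|Np0] := posnP (Np p); first by rewrite mul0r; lra.
  have Np1 : (Np p)%:R * lnn p <= lnn p by rewrite ler_piMl // lern1.
  have [py|yp] := leqP p y.-1.
    by apply: le_trans Np1 _; move: t2; rewrite /T2 ltnS py; lra.
  have [i id pi] : exists2 i, (i < d)%N & (p %| k - i + a)%N.
    have : has (fun j => p %| j + a)%N W.
      apply: contraLR Np0 => /hasPn nW; rewrite -leqNgt leqn0 /Np big_seq big1 //.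
      by move=> j /nW /negbTE->.
    case/hasP => j; rewrite mem_index_iota => jr pj; exists (k - j)%N; first by clear -jr d0; lia.
    by rewrite subKn //; clear -jr; lia.
  have yp' : (y <= p)%N by clear -yp; lia.
  apply: le_trans Np1 _.
  have big (V : seq nat) (Q : nat -> bool) m : m \in V -> Q m ->
      lnn p <= (\sum_(m <- V) Q m)%:R * lnn p.
    move=> mV Qm; rewrite ler_peMl // ler1n (big_rem m) //= Qm //.
  case: (fail p i pp p4 yp' id pi) => [[m mr pm]|[m mr pm]].
    by have := big V1 (fun m => p %| m + a)%N m; rewrite mem_index_iota ltnS mr => /(_ isT pm); rewrite -/(T3 p); lra.
  by have := big V2 (fun m => p ^ 2 %| m + a)%N m; rewrite mem_index_iota ltnS mr => /(_ isT pm); rewrite -/(T4 p); lra.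
have d4K : lnn (4 * d) <= lnn (2 * K).
  by apply: ler_lnn; clear -d0 dk kK; lia.
have lK := lnn_ge0 R (2 * K).
(* The 6 is 2 + 4: 2 d log (4d) from the sum of log p / p, and 4d log (4d) from the trivial bound on
   the sum of log p. Moreover 4d <= 2k <= 2K. *)
have sT1 : \sum_(0 <= p < K.+1 | prime p) T1 p <= 6 * lnn (2 * K) * d%:R.
  rewrite /T1 -big_mkcondr /=.
  apply: le_trans (ler_sum_nat_subrange K.+1 (N := (4 * d).+1) prime _ _) _ => //.
    by move=> p; rewrite addr_ge0 ?mulr_ge0 ?invr_ge0 ?lnn_ge0.
  rewrite big_split /= -mulr_sumr.
  have d40 : (0 < 4 * d)%N by clear -d0; lia.
  have A1 := sum_ln_prime_div R d40; have A2 := sum_ln_primes_le R (4 * d).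
  set u := \sum_(_ <= _ < _ | _) _ in A1 *; set v := \sum_(_ <= _ < _ | _) _ in A2 *.
  apply: (@le_trans _ _ (d%:R * (2 * lnn (4 * d)) + (4 * d)%:R * lnn (4 * d))).
    by rewrite lerD // ler_pM2l ?ltr0n.
  have -> : d%:R * (2 * lnn (4 * d)) + (4 * d)%:R * lnn (4 * d) = 6 * d%:R * lnn (4 * d).
    by rewrite [(4 * d)%:R]natrM; ring.
  by rewrite mulrAC ler_wpM2r // ler_wpM2l.
have sT2 : \sum_(0 <= p < K.+1 | prime p) T2 p <= 3 * lnn Y.
  rewrite /T2 -big_mkcondr /=.
  apply: le_trans (ler_sum_nat_subrange K.+1 (N := y.-1.+1) prime _ _) _ => //.
    by move=> p; rewrite lnn_ge0.
  apply: le_trans (sum_ln_primes_le R y.-1) _.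
  have [->|y1] := posnP y.-1; first by rewrite mul0r mulr_ge0 ?lnn_ge0.
  by rewrite -!lnnX // ler_lnn // expn_gt0 y1.
have sT3 : \sum_(0 <= p < K.+1 | prime p) T3 p <= 4 * c1 * d%:R.
  rewrite /T3 -sum_nat_exchange.
  apply: (@le_trans _ _ (\sum_(m <- V1) smooth_log K B (m + a))).
    rewrite big_seq [leRHS]big_seq; apply: ler_sum => m; rewrite mem_index_iota => mr.
    by rewrite /smooth_log inB //; clear -mr kK; lia.
  apply: le_trans (H1 _) _.
  have -> : 4 * c1 * d%:R = c1 * (4 * d)%:R by rewrite natrM; ring.
  by apply: ler_wpM2l; [exact: ltW | rewrite ler_nat geq_minl].
have sT4 : \sum_(0 <= p < K.+1 | prime p) T4 p <= 8 * (y%:R * lam) * d%:R.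
  rewrite /T4 -sum_nat_exchange.
  apply: (@le_trans _ _ (\sum_(m <- V2) square_log B (m + a))).
    rewrite big_seq [leRHS]big_seq; apply: ler_sum => m; rewrite mem_index_iota => mr.
    rewrite /square_log inB; last by clear -mr kK; lia.
    rewrite (big_nat_widen _ _ B) // big_mkcond [leRHS]big_mkcond /=; apply: ler_sum => p _.
    by case: (prime p && _) => //=; case: ifP => // _; exact: lnn_ge0.
  apply: le_trans (H2 _) _.
  have -> : 8 * (y%:R * lam) * d%:R = lam * (8 * d * y)%:R by rewrite !natrM; ring.
  by rewrite ler_wpM2l // ler_nat geq_minl.
have d1 : 1 <= d%:R :> R by rewrite ler1n.
have lY := lnn_ge0 R Y.
have total : \sum_(0 <= p < K.+1 | prime p) (Np p)%:R * lnn p <=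
    6 * lnn (2 * K) * d%:R + 3 * lnn Y * d%:R + 4 * c1 * d%:R + 8 * (y%:R * lam) * d%:R.
  apply: le_trans (ler_sum _ S3) _; rewrite !big_split /=.
  have : 3 * lnn Y <= 3 * lnn Y * d%:R by rewrite ler_peMr // mulr_ge0.
  by lra.
move: S1; rewrite big_split /= S2 big_const_seq iter_addr_0 count_predT szW -mulr_natr.
have : (6 * lnn Y + 6 * lnn (2 * K) + 4 * c1 + 8 * (y%:R * lam)) * d%:R < l / 2 * d%:R.
  by rewrite ltr_pM2r // (lt_le_trans ltr01).
by move: total; lra.
Qed.

Lemma typical_good_alpha : good_alpha K a.
Proof. exact: good_alpha_criterion typical_few_bad typical_newton. Qed.

End Typical.

(** * Densities *)

Section Counting.
Variable R : realType.
Local Notation lnn n := (ln (n%:R : R)).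

(* The one-sided Hardy-Littlewood maximal inequality on the integers: the bad
   starting points are covered greedily by disjoint intervals on which the mean
   of [F] exceeds [lam]. *)
Lemma maximal_count (F : nat -> R) M (lam : R) n :
  (forall i, 0 <= F i) -> (forall i, (M <= i)%N -> F i = 0) -> 0 < lam ->
  lam * (count (fun a => `[< exists d, lam * d%:R < \sum_(1 <= m < d.+1) F (m + a)%N >])
    (iota 1 n))%:R <= \sum_(1 <= i < M) F i.
Proof.
move=> F0 FM lam0; set P := fun a => _; rewrite -/P.
pose S s := \sum_(s.+1 <= i < M) F i.
have SE s N : (M <= N)%N -> S s = \sum_(s.+1 <= i < N) F i.
  move=> MN; rewrite /S (big_nat_widen _ _ N) // big_mkcond /=.
  by apply: eq_bigr => i _; case: ltnP => // /FM->.
have S_cat s d : S s = \sum_(s.+1 <= i < (s + d).+1) F i + S (s + d)%N.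
  rewrite (SE s (maxn M (s + d).+1)) ?leq_maxl // (SE (s + d)%N (maxn M (s + d).+1)) ?leq_maxl //.
  by rewrite -big_cat_nat ?leq_maxr // ltnS leq_addr.
have S0 s : 0 <= S s by rewrite sumr_ge0.
suff H N s : lam * (count P (iota s N))%:R <= S s.
  apply: le_trans (H n 1%N) _.
  by rewrite -[leRHS]/(S 0%N) (S_cat 0%N 1%N) add0n big_nat1 lerDr.
elim/ltn_ind: N s => -[|N] IH s; first by rewrite mulr0.
have [Ps|nPs] := boolP (P s); last first.
  rewrite /= (negbTE nPs) add0n; apply: le_trans (IH N (ltnSn N) s.+1) _.
  by rewrite (S_cat s 1%N) addn1 lerDr big_nat1.
have /asboolP[[|d] dP] := Ps; first by rewrite mulr0 big_geq // ltxx in dP.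
have eS : \sum_(1 <= m < d.+2) F (m + s)%N = \sum_(s.+1 <= i < (s + d.+1).+1) F i.
  by rewrite -[s.+1]add1n big_addn -addSn addSnnS addnC addnK.
rewrite eS in dP; rewrite (S_cat s d.+1).
have cP : (count P (iota s N.+1) <= d.+1 + count P (iota (s + d.+1) (N.+1 - d.+1)))%N.
  have [le|lt] := leqP d.+1 N.+1.
    rewrite -{1}(subnKC le) iotaD count_cat leq_add2r.
    by rewrite (leq_trans (count_size _ _)) // size_iota.
  by rewrite (leq_trans (count_size _ _)) // size_iota (leq_trans (ltnW lt)) // leq_addr.
apply: (@le_trans _ _ (lam * d.+1%:R + lam * (count P (iota (s + d.+1) (N.+1 - d.+1)))%:R)).
  by rewrite -mulrDr ler_pM2l // -natrD ler_nat.
by apply: lerD; [exact: ltW | apply: IH; rewrite subSS ltnS leq_subr].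
Qed.

Lemma sum_smooth_log K B : (0 < K)%N ->
  \sum_(1 <= i < B) smooth_log R K B i <= B%:R * (2 * lnn K).
Proof.
move=> K0; case: B => [|B]; first by rewrite big_geq // mul0r.
apply: (@le_trans _ _ (\sum_(1 <= i < B.+1) \sum_(0 <= p < K.+1 | prime p && (p %| i)%N) lnn p)).
  by rewrite big_nat [leRHS]big_nat; apply: ler_sum => i /andP[i0 iB]; rewrite /smooth_log i0 iB.
rewrite (@sum_exchange_dvd R K.+1 B prime id).
apply: (@le_trans _ _ (B.+1%:R * \sum_(0 <= p < K.+1 | prime p) lnn p / p%:R)).
  rewrite mulr_sumr; apply: ler_sum => p pp; have p0 := prime_gt0 pp.
  rewrite mulrA mulrAC ler_wpM2r ?lnn_ge0 // ler_pdivlMr ?ltr0n // -natrM ler_nat.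
  by rewrite (leq_trans (leq_divM _ _)).
by rewrite ler_pM2l ?ltr0n // sum_ln_prime_div.
Qed.

Lemma sum_square_log B : \sum_(1 <= i < B) square_log R B i <= B%:R * 2.
Proof.
case: B => [|B]; first by rewrite big_geq // mul0r.
apply: (@le_trans _ _ (\sum_(1 <= i < B.+1) \sum_(0 <= p < B.+1 | prime p && (p ^ 2 %| i)%N) lnn p)).
  by rewrite big_nat [leRHS]big_nat; apply: ler_sum => i /andP[i0 iB]; rewrite /square_log i0 iB.
rewrite (@sum_exchange_dvd R B.+1 B prime (fun p => p ^ 2)%N).
apply: (@le_trans _ _ (B.+1%:R * \sum_(2 <= p < B.+1) lnn p / (p ^ 2)%:R)); last first.
  by rewrite ler_pM2l ?ltr0n // sum_ln_div_sqr.
rewrite [in leRHS](@big_nat_widenl _ _ _ 2 0%N) //= mulr_sumr big_mkcond [leRHS]big_mkcond /=.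
apply: ler_sum => p _; case: (boolP (prime p)) => [pp|_]; last first.
  by case: ifP => // _; rewrite !mulr_ge0 ?lnn_ge0 ?invr_ge0.
rewrite prime_gt1 // mulrA mulrAC ler_wpM2r ?lnn_ge0 // ler_pdivlMr ?ltr0n ?expn_gt0 ?prime_gt0 //.
by rewrite -natrM ler_nat (leq_trans (leq_divM _ _)).
Qed.

(** A pair (j, s) accounts for at most B / s^2 values of a, and the sum of 1 / s^2 over s > Y is at
    most 1 / Y. *)
Lemma count_large_square n K Y B : (0 < Y)%N -> (n + K < B)%N ->
  (count (fun a => `[< exists s j, [/\ (0 < j <= K)%N, (s ^ 2 %| j + a)%N & (Y < s)%N] >])
     (iota 1 n))%:R <= K%:R * (B%:R / Y%:R) :> R.
Proof.
move=> Y0 nKB; set P := fun a => _.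
have PE a : (0 < a <= n)%N -> (P a <= \sum_(1 <= j < K.+1) \sum_(Y.+1 <= s < B) (s ^ 2 %| j + a))%N.
  move=> an; rewrite /P; case: asboolP => // -[s [j [jK sd Ys]]].
  have sB : (s < B)%N.
    have ja : (0 < j + a)%N by lia.
    have := dvdn_leq ja sd; rewrite -mulnn; nia.
  rewrite (big_rem j) /=; last by rewrite mem_index_iota; lia.
  rewrite (big_rem s) /=; last by rewrite mem_index_iota; lia.
  by rewrite sd.
rewrite -sum1_count big_mkcond /= natr_sum.
have -> : iota 1 n = index_iota 1 n.+1 by rewrite /index_iota subn1.
apply: (@le_trans _ _ (\sum_(1 <= a < n.+1) \sum_(1 <= j < K.+1) \sum_(Y.+1 <= s < B) (s ^ 2 %| j + a)%:R)).
  rewrite big_nat [leRHS]big_nat; apply: ler_sum => a an.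
  apply: (@le_trans _ _ ((P a)%:R)); first by case: (P a); rewrite lexx.
  have := PE a an; rewrite -(ler_nat R) => /le_trans; apply.
  by rewrite natr_sum; apply: ler_sum => j _; rewrite natr_sum.
rewrite exchange_big /=.
apply: (@le_trans _ _ (\sum_(1 <= j < K.+1) (B%:R / Y%:R))); last first.
  by rewrite sumr_const_nat subSS subn0 -(mulr_natl (B%:R / Y%:R)).
rewrite big_nat [leRHS]big_nat; apply: ler_sum => j jK.
rewrite exchange_big /=.
apply: (@le_trans _ _ (B%:R * \sum_(Y.+1 <= s < B) (s ^ 2)%:R^-1)); last first.
  by rewrite ler_wpM2l // sum_inv_sqr.
rewrite mulr_sumr big_nat [leRHS]big_nat; apply: ler_sum => s /andP[sY _].
have s0 : (0 < s ^ 2)%N by rewrite expn_gt0 (leq_ltn_trans _ sY).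
rewrite -natr_sum ler_pdivlMr ?ltr0n // -natrM ler_nat.
have le : (\sum_(1 <= a < n.+1) (s ^ 2 %| j + a) <= B.-1 %/ s ^ 2)%N.
  rewrite divn_count_dvd prednK; last by lia.
  have -> : (\sum_(1 <= a < n.+1) (s ^ 2 %| j + a) = \sum_(j.+1 <= t < (n + j).+1) (s ^ 2 %| t))%N.
    rewrite -[j.+1]add1n big_addn -addSn addnK.
    by apply: eq_bigr => a _; rewrite addnC.
  rewrite (big_cat_nat (n := j.+1) (p := B)) //=; try lia.
  rewrite [X in (_ <= _ + X)%N](big_cat_nat (n := (n + j).+1)) //=; lia.
apply: leq_trans (leq_mul le (leqnn _)) _.
by rewrite (leq_trans (leq_divM _ _)) // leq_pred.
Qed.

(** The few a below the square root of n are discarded, so that log a is at least half of log n. *)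
Lemma count_small_sqr n m : (count (fun a => a ^ 2 < n) (iota 1 m) ^ 2 <= n)%N.
Proof.
elim: m => [|m IH]; first by rewrite exp0n.
rewrite -(addn1 m) iotaD count_cat /= add1n addn0.
case: (ltnP (m.+1 ^ 2) n) => [lt|_]; last by rewrite addn0.
apply: leq_trans (ltnW lt); rewrite leq_exp2r // addn1 ltnS.
by rewrite (leq_trans (count_size _ _)) // size_iota.
Qed.

End Counting.

(** * Choice of parameters and the limit *)

Section Limit.
Variable R : realType.
Local Notation lnn n := (ln (n%:R : R)).

Lemma lnn4_ge1 m : (4 <= m)%N -> 1 <= lnn m.
Proof.
move=> m4; apply: le_trans (_ : lnn 4 <= _); last exact: ler_lnn.
have e1 : expR (1 / 2) <= 2 :> R.
  have h : 2^-1 <= expR (- (1 / 2)) :> R by apply: le_trans (expR_ge1Dx _); lra.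
  rewrite expRN in h; have e0 := expR_gt0 (1 / 2 : R).
  by rewrite -lef_pV2 ?posrE.
have e4 : expR 1 <= 2 * 2 :> R.
  have -> : expR 1 = expR (1 / 2 + 1 / 2) :> R by congr expR; lra.
  by rewrite expRD; apply: ler_pM => //; exact: expR_ge0.
have e4' : 2 * 2 = 4%:R :> R by rewrite -natrM.
by rewrite -[X in X <= _](expRK (1 : R)) ler_ln ?posrE ?expR_gt0 // -e4'.
Qed.

(* For such [y], primes [p >= y] divide numbers without square divisors beyond
   [Y ^ 2] to multiplicity at most [y] only (see [logn_bound]), while the
   logarithms of the primes below [y] sum to at most [3 ln Y]. *)
Lemma exists_self_power Y : (0 < Y)%N -> exists y,
  [/\ (0 < y)%N, (Y ^ 3 <= y ^ y)%N, (y.-1 ^ y.-1 <= Y ^ 3)%N & y%:R <= 3 * lnn Y + 5].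
Proof.
move=> Y0; have ex : exists y, (0 < y)%N && (Y ^ 3 <= y ^ y)%N.
  have Y3 : (0 < Y ^ 3)%N by rewrite expn_gt0 Y0.
  exists (Y ^ 3)%N; rewrite Y3 /=.
  by rewrite -{1}(expn1 (Y ^ 3)) leq_pexp2l.
case: (ex_minnP ex) => y /andP[y0 yY] ymin.
have Yy : (y.-1 ^ y.-1 <= Y ^ 3)%N.
  have [->|y1] := posnP y.-1; first by rewrite expn0 expn_gt0 Y0.
  rewrite leqNgt; apply/negP => lt.
  by have := ymin y.-1; rewrite y1 ltnW //= => /(_ isT); rewrite leqNgt prednK // leqnn.
exists y; split => //; have lY := lnn_ge0 R Y.
have [y5|y5] := leqP y 5.
  by apply: (@le_trans _ _ 5%:R); [rewrite ler_nat | lra].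
have y4 : (4 <= y.-1)%N by clear -y5; lia.
have : y.-1%:R <= 3 * lnn Y.
  apply: (@le_trans _ _ (y.-1%:R * lnn y.-1)); first by rewrite ler_peMr // lnn4_ge1.
  by rewrite -!lnnX ?(leq_trans _ y4) // ler_lnn // expn_gt0 (leq_trans _ y4).
have : y%:R = y.-1%:R + 1 :> R by rewrite natr1 prednK.
by lra.
Qed.

Lemma count_or (T : Type) (P Q S : pred T) (s : seq T) :
  (forall x, P x -> Q x || S x) -> (count P s <= count Q s + count S s)%N.
Proof.
move=> H; elim: s => //= x s IH; rewrite addnACA leq_add //.
by have := H x; case: (P x) => [/(_ isT)|_] //; case: (Q x); case: (S x).
Qed.

(** Each of the four exceptional sets [E1] to [E4] is given a quarter of the allowance tau n. *)
Lemma few_bad_alpha (tau : R) : 0 < tau -> exists kappa l0 : R, 0 < kappa /\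
  forall n K, (0 < K)%N -> l0 <= lnn n -> lnn K <= kappa * lnn n ->
  (count (fun a => ~~ `[< good_alpha K a >]) (iota 1 n))%:R <= tau * n%:R.
Proof.
move=> tau0; pose lam : R := 24 / tau; have lam0 : 0 < lam by rewrite divr_gt0.
pose eta : R := (16 * (6 + 24 * lam))^-1.
have den0 : 0 < 16 * (6 + 24 * lam) by lra.
have eta0 : 0 < eta by rewrite invr_gt0.
have etaE : 16 * (6 * eta + 24 * (lam * eta)) = 1.
  have e : 16 * (6 + 24 * lam) * eta = 1 by rewrite mulfV // gt_eqF.
  by rewrite -[RHS]e; ring.
have lamE : lam * tau = 24 by rewrite /lam divfK // gt_eqF.
clearbody eta lam; have le0 : 0 < lam * eta by rewrite mulr_gt0.
(* The caps make, in this order, the mean of [smooth_log] small against c1 = l / 64, the term 6 log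
   (2K) small in [HN], and K at most n^(eta / 2), well below Y. *)
pose kappa : R := Num.min (Num.min (tau / 1536) (1 / 100)) (eta / 2).
have kappa0 : 0 < kappa.
  by rewrite /kappa !lt_min -!andbA; apply/and3P; split; lra.
have [k1 k2 k3] : [/\ kappa <= tau / 1536, kappa <= 1 / 100 & kappa <= eta / 2].
  by rewrite /kappa !ge_min !lexx !orbT.
(* The summands absorb the constants 40 lam + 6 in [HN], give K / Y <= tau / 12, and make the square
   root of n at most tau n / 4. *)
clearbody kappa; pose l0 : R := 16 * (40 * lam + 6) + 48 / (tau * eta) + 16 / tau ^+ 2.
have q1 : 0 < 48 / (tau * eta) by rewrite divr_gt0 ?mulr_gt0.
have q2 : 0 < 16 / tau ^+ 2 by rewrite divr_gt0 ?exprn_gt0.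
exists kappa, l0; split => // n K K0; set l := lnn n => l0l lK.
have lbig : 16 * (40 * lam + 6) <= l by move: l0l; rewrite /l0; lra.
have l_2 : 48 / (tau * eta) <= l by move: l0l; rewrite /l0; lra.
have l_3 : 16 / tau ^+ 2 <= l by move: l0l; rewrite /l0; lra.
have lpos : 0 < l by lra.
have n0 : (0 < n)%N.
  by rewrite lt0n; apply: contraTneq lpos => n0; rewrite /l n0 ln0 // ltxx.
have n0' : 0 < n%:R :> R by rewrite ltr0n.
have ln_le : l <= n%:R.
  apply: (@le_trans _ _ (n%:R - 1)); last by rewrite gerBl.
  have := @le_ln1Dx R (n%:R - 1); rewrite addrCA subrr addr0; apply.
  by rewrite ltrBrDl addrN.
have KE : K%:R <= expR (kappa * l).
  by rewrite -[X in X <= _](lnK (x := K%:R)) ?posrE ?ltr0n // ler_expR.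
have Kn : (K <= n)%N.
  rewrite -(ler_nat R); apply: le_trans KE _.
  rewrite -[X in _ <= X](lnK (x := n%:R)) ?posrE // ler_expR -/l.
  by rewrite ger_pMl //; lra.
(* Y is about n^eta: its logarithm is a small fraction of log n, yet it exceeds K / tau. *)
pose Y := Num.truncn (expR (eta * l)).
have el0 : 0 <= eta * l by rewrite mulr_ge0 ?ltW.
have eY1 : 1 <= expR (eta * l) by rewrite -expR0 ler_expR.
have Y0 : (0 < Y)%N by rewrite truncn_gt0.
have [Yle Ylt] : Y%:R <= expR (eta * l) /\ expR (eta * l) < Y.+1%:R.
  by have /andP[] := truncn_itv (ltW (lt_le_trans ltr01 eY1)).
have lY : lnn Y <= eta * l.
  by rewrite -[X in _ <= X](expRK (eta * l)) ler_ln ?posrE ?ltr0n ?expR_gt0.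
have lY0 := lnn_ge0 R Y.
have KY : K%:R / Y%:R <= tau / 12.
  have Y1 : 1 <= Y%:R :> R by rewrite ler1n.
  have Y2 : expR (eta * l) <= 2 * Y%:R by move: Ylt; rewrite -natr1; clear -Y1; lra.
  rewrite ler_pdivrMr ?ltr0n //.
  have e2 : 24 / tau * expR (kappa * l) <= expR (eta * l).
    have -> : eta * l = (eta - kappa) * l + kappa * l by ring.
    rewrite expRD ler_pM2r ?expR_gt0 //.
    apply: (@le_trans _ _ (1 + (eta - kappa) * l)); last exact: expR_ge1Dx.
    apply: (@le_trans _ _ (eta / 2 * l)); last first.
      have : eta / 2 * l <= (eta - kappa) * l by rewrite ler_pM2r //; clear -k3; lra.
      by clear -lpos; lra.
    rewrite mulrAC ler_pdivlMr // -ler_pdivrMl // .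
    by apply: le_trans l_2; rewrite invfM; clear; lra.
  have e3 : expR (kappa * l) <= tau / 24 * expR (eta * l).
    by rewrite -ler_pdivrMl ?divr_gt0 // invf_div.
  by apply: le_trans KE (le_trans e3 _); clear -Y2 tau0; have t24 : 0 < tau / 24; [lra | nra].
have [y [y0 yY Yy yl]] := exists_self_power Y0.
pose B := (2 * n).+1.
have B3 : B%:R <= 3 * n%:R :> R by rewrite -natrM ler_nat /B; clear -n0; lia.
pose c1 : R := l / 64; have c10 : 0 < c1 by rewrite divr_gt0.
pose E1 a := `[< exists d, c1 * d%:R < \sum_(1 <= m < d.+1) smooth_log R K B (m + a)%N >].
pose E2 a := `[< exists d, lam * d%:R < \sum_(1 <= m < d.+1) square_log R B (m + a)%N >].
pose E3 a := `[< exists s j, [/\ (0 < j <= K)%N, (s ^ 2 %| j + a)%N & (Y < s)%N] >].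
pose E4 a := (a ^ 2 < n)%N.
have bad a : (0 < a <= n)%N -> ~~ `[< good_alpha K a >] -> [|| E1 a, E2 a, E3 a | E4 a].
  move=> /andP[a0 an] /asboolPn nga; apply: contrapT => no; apply: nga.
  have [n1 n2 n3 n4] : [/\ ~ E1 a, ~ E2 a, ~ E3 a & ~ E4 a].
    by split=> e; apply: no; rewrite e ?orbT.
  apply: (@typical_good_alpha R K Y y B a l c1 lam) => //.
  - by clear -Kn an; rewrite /B; lia.
  - exact: ltW.
  - by move=> d; rewrite leNgt; apply/negP => H; apply: n1; apply: asboolT; exists d.
  - by move=> d; rewrite leNgt; apply/negP => H; apply: n2; apply: asboolT; exists d.
  - by move=> s j jK sd; rewrite leqNgt; apply/negP => H; apply: n3; apply: asboolT; exists s, j.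
  - move/negP: n4; rewrite /E4 -leqNgt => n4; move: (ler_lnn R n0 n4) (lnnX R 2 a0).
    by rewrite -/l; clear; lra.
  - have el : eta * l <= 1 / 96 * l by rewrite ler_pM2r //; clear -etaE le0; lra.
    by rewrite /c1; clear -lY el lpos; lra.
  - have lK2 : lnn (2 * K) <= 1 + kappa * l.
      rewrite lnnM //; have : lnn 2 <= 1 by have := @le_ln1Dx R 1; rewrite -natr1 => ->.
      lra.
    have kl : kappa * l <= 1 / 100 * l by rewrite ler_pM2r.
    have yl2 : y%:R * lam <= (3 * (eta * l) + 5) * lam.
      by rewrite ler_pM2r //; clear -yl lY; lra.
    have eE : (6 * eta + 24 * (lam * eta)) * l = l / 16.
      have -> : 6 * eta + 24 * (lam * eta) = 1 / 16 by clear -etaE; lra.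
      by clear; lra.
    rewrite /c1; have : (6 * eta + 24 * (lam * eta)) * l = 6 * (eta * l) + 8 * (3 * (eta * l) * lam) by ring.
    by rewrite mulrDl in yl2; clear -yl2 eE lK2 kl lY lbig lpos lam0; lra.
have cnt : (count (fun a => ~~ `[< good_alpha K a >]) (iota 1 n) <=
    count E1 (iota 1 n) + (count E2 (iota 1 n) + (count E3 (iota 1 n) + count E4 (iota 1 n))))%N.
  have -> : count (fun a => ~~ `[< good_alpha K a >]) (iota 1 n) =
      count (fun a => (0 < a <= n)%N && ~~ `[< good_alpha K a >]) (iota 1 n).
    by apply: eq_in_count => a; rewrite mem_iota add1n ltnS => ->.
  apply: leq_trans (count_or (S := predU E2 (predU E3 E4)) (Q := E1) _ _) _.
    by move=> a /andP[ar ga] /=; exact: bad.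
  rewrite leq_add2l; apply: leq_trans (count_or (Q := E2) (S := predU E3 E4) _ _) _ => //.
  by rewrite leq_add2l; apply: count_or.
have c_1 : (count E1 (iota 1 n))%:R <= tau / 4 * n%:R.
  have := maximal_count n (smooth_log_ge0 R K B) (M := B) _ c10.
  move=> /(_ _)/wrap[i Bi|]; first by rewrite /smooth_log [(i < B)%N]ltnNge Bi andbF.
  rewrite -/E1; set c := (count _ _)%:R => H.
  have := le_trans H (sum_smooth_log R B K0) => {}H.
  have H2 : B%:R * (2 * lnn K) <= 3 * n%:R * (2 * (tau / 1536 * l)).
    apply: ler_pM; rewrite ?mulr_ge0 ?lnn_ge0 // ler_pM2l //.
    by apply: le_trans lK _; rewrite ler_pM2r.
  have := le_trans H H2; rewrite /c1 => {}H.
  rewrite -(ler_pM2l c10); apply: le_trans H _; rewrite /c1.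
  by rewrite le_eqVlt; apply/orP; left; apply/eqP; field.
have c_2 : (count E2 (iota 1 n))%:R <= tau / 4 * n%:R.
  have := maximal_count n (square_log_ge0 R B) (M := B) _ lam0.
  move=> /(_ _)/wrap[i Bi|]; first by rewrite /square_log [(i < B)%N]ltnNge Bi andbF.
  rewrite -/E2; set c := (count _ _)%:R => H.
  have {}H := le_trans H (sum_square_log R B).
  rewrite -(ler_pM2l lam0); apply: le_trans H _.
  have -> : lam * (tau / 4 * n%:R) = 3 * n%:R * 2 by rewrite mulrA mulrA lamE; field.
  by rewrite ler_pM2r.
have c_3 : (count E3 (iota 1 n))%:R <= tau / 4 * n%:R.
  have nKB : (n + K < B)%N by clear -Kn; rewrite /B; lia.
  apply: le_trans (count_large_square R Y0 nKB) _.
  rewrite mulrCA; apply: (@le_trans _ _ (3 * n%:R * (tau / 12))); last by clear; lra.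
  by apply: ler_pM => //; rewrite divr_ge0.
have c_4 : (count E4 (iota 1 n))%:R <= tau / 4 * n%:R.
  have : (count E4 (iota 1 n) ^ 2 <= n)%N := count_small_sqr n n.
  rewrite -(ler_nat R) natrX => H.
  have t0 : 0 <= tau / 4 * n%:R by rewrite mulr_ge0 // divr_ge0 // ltW.
  rewrite -(@ler_pXn2r _ 2) ?nnegrE //.
  apply: le_trans H _; rewrite exprMn expr2 mulrA ler_peMl //.
  have : 16 / tau ^+ 2 <= n%:R by exact: le_trans l_3 ln_le.
  rewrite ler_pdivrMr ?exprn_gt0 // => H.
  by have -> : (tau / 4) ^+ 2 * n%:R = n%:R * tau ^+ 2 / 16; [field | clear -H; lra].
move: cnt; rewrite -(ler_nat R) !natrD => cnt.
by apply: le_trans cnt _; clear -c_1 c_2 c_3 c_4; lra.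
Qed.

End Limit.

Lemma card_prob_unif n (P : nat -> Prop) :
  #|[set a : 'I_n | `[< P a.+1 >]]%SET| = count (fun a => `[< P a >]) (iota 1 n).
Proof.
have -> : iota 1 n = index_iota 1 n.+1 by rewrite /index_iota subn1.
rewrite -sum1dep_card -sum1_count.
by rewrite big_add1 /= big_mkord.
Qed.

Lemma prob_unif_bound (R : realType) n (P : nat -> Prop) (tau : R) : (0 < n)%N ->
  (count (fun a => ~~ `[< P a >]) (iota 1 n))%:R <= tau * n%:R ->
  `|1 - prob_unif n P| <= tau.
Proof.
move=> n0 le; have n0' : 0 < n%:R :> R by rewrite ltr0n.
have e : 1 - prob_unif n P = (count (fun a => ~~ `[< P a >]) (iota 1 n))%:R / n%:R :> R.
  rewrite /prob_unif card_prob_unif.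
  have := count_predC (fun a => `[< P a >]) (iota 1 n); rewrite size_iota => nE.
  have -> : (count (fun a => ~~ `[< P a >]) (iota 1 n))%:R =
      n%:R - (count (fun a => `[< P a >]) (iota 1 n))%:R :> R.
    by rewrite -[in n%:R]nE natrD addrC addKr.
  by rewrite mulrBl mulfV // gt_eqF.
by rewrite e ger0_norm ?divr_ge0 // ler_pdivrMr.
Qed.

Unset Implicit Arguments.

Theorem theorem2 (R : realType) (kmax : R -> nat)
  (kmax_pos : forall x : R, (0 < kmax x)%N)
  (kmax_small : (fun x : R => ln ((kmax x)%:R : R) / ln x) @ +oo --> (0 : R)) :
  (fun x : R => prob_unif (R := R) (Num.truncn x) (good_alpha (kmax x)))
    @ +oo --> (1 : R).
Proof.
apply/cvgrPdist_le => tau tau0.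
have [kappa [l0 [kappa0 few]]] := few_bad_alpha tau0.
(* Half of kappa suffices after truncation: log x <= 2 log n for x >= 4. *)
have kappa2 : 0 < kappa / 2 by rewrite divr_gt0.
move/cvgrPdist_le : kmax_small => /(_ _ kappa2) small.
near=> x.
have x4 : 4 <= x by near: x; exact: nbhs_pinfty_ge.
have xl0 : expR (2 * l0) <= x by near: x; exact: nbhs_pinfty_ge.
have xs : `|0 - ln (kmax x)%:R / ln x| <= kappa / 2 by near: x.
have x0 : 0 < x by lra.
have /andP[nx xn] := truncn_itv (ltW x0).
set n := Num.truncn x in nx xn *.
have xn2 : x <= 2 * n%:R by move: xn; rewrite -natr1; lra.
have n0 : (0 < n)%N by rewrite -(ltr0n R); lra.
have lx4 : 2 * ln 2 <= ln x.
  have -> : 2 * ln 2 = ln (2 * 2) :> R by rewrite lnM ?posrE //; lra.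
  by rewrite ler_ln ?posrE //; lra.
have ln2 : 0 < ln 2 :> R by rewrite ln_gt0 // ltr1n.
have lxn : ln x <= ln 2 + ln (n%:R : R).
  by rewrite -lnM ?posrE ?ltr0n // ler_ln ?posrE ?mulr_gt0 ?ltr0n.
have xl : 2 * l0 <= ln x by rewrite -[leLHS]expRK ler_ln ?posrE ?expR_gt0.
apply: prob_unif_bound => //; apply: few => //; first by lra.
have lx0 : 0 < ln x by lra.
move: xs; rewrite sub0r normrN => /(le_trans (ler_norm _)).
rewrite ler_pdivrMr // => /le_trans; apply.
have : kappa / 2 * ln x <= kappa / 2 * (2 * ln (n%:R : R)) by rewrite ler_pM2l //; lra.
by lra.
Unshelve. all: by end_near.
Qed.
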